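(* For any integers $k \geq 1$, $d \geq 2$, and any subgroup $D \leq \mathrm{Sym}(d)$, the group $\mathrm{AAut}_{D}(\mathcal{T}_{d,k})$ of almost automorphisms of $\mathcal{T}_{d,k}$ that are piecewise of type $W(D)$, endowed with its group topology for which $W_k(D)$ is an open subgroup, is compactly presented.
   Context: Trees. Let $A,B$ be finite sets with $|A|=k\ge 1$, $|B|=d\ge 2$. $\mathcal{T}_{d,k}$ is the rooted tree whose vertices are the empty word (the root) and the finite words $ab_1\cdots b_n$ ($n\geq 0$, $a\in A$, $b_i\in B$), with $v$ and $vx$ adjacent; so the root has $k$ children and every other vertex has $d$ children. $\mathcal{T}_d=\mathcal{T}_{d,d}$ is the rooted $d$-regular tree. For a vertex $v$, $\mathcal{T}_{d,k}^v$ is the subtree of vertices having $v$ as a prefix; for $v\neq$ root it is identified with $\mathcal{T}_d$ (using fixed orderings of $A$ and $B$, which order the children of every vertex). $\partial_\infty\mathcal{T}_{d,k}$ is the set of infinite rays from the root with its usual (Cantor set) topology. $\mathrm{Aut}(\mathcal{T}_{d,k})$ is the group of root-fixing automorphisms. Almost automorphisms. A finite subtree $T$ of $\mathcal{T}_{d,k}$ is a (finite) rooted complete subtree if it contains the root as a vertex of degree $k$ and every other vertex of $T$ which is not a leaf has degree $d+1$ in $T$. The complement $\mathcal{T}_{d,k}\setminus T$ is regarded as the forest of the subtrees $\mathcal{T}_{d,k}^v$, $v$ a leaf of $T$. $\mathrm{AAut}(\mathcal{T}_{d,k})$ is the group of homeomorphisms of $\partial_\infty\mathcal{T}_{d,k}$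 induced by triples $(\psi,T,T')$, where $T,T'$ are finite rooted complete subtrees with the same number of leaves and $\psi:\mathcal{T}_{d,k}\setminus T\to\mathcal{T}_{d,k}\setminus T'$ is a forest isomorphism (mapping each component onto a component by a rooted tree isomorphism, bijectively on components). The groups $W(D)$, $W_k(D)$, $\mathrm{AAut}_D$. For $D\leq \mathrm{Sym}(d)$, let $D_1=D$, viewed as the subgroup of $\mathrm{Aut}(\mathcal{T}_d)$ permuting the subtrees hanging at level one, and $D_{n+1}=D\wr D_n$ (permutational wreath product for the action of $D_n$ on the level $n$ vertices of $\mathcal{T}_d$); i.e. $D_n$ consists of the automorphisms whose local permutation is in $D$ at vertices of level $<n$ and trivial at vertices of level $\geq n$. $W(D)$ is the closed subgroup of $\mathrm{Aut}(\mathcal{T}_d)$ generated by all $D_n$. $W_k(D)\leq\mathrm{Aut}(\mathcal{T}_{d,k})$ is the subgroup fixing level one pointwise and acting by an element of $W(D)$ on each subtree rooted at level one. $\mathrm{AAut}_D(\mathcal{T}_{d,k})$ is the subgroup of $\mathrm{AAut}(\mathcal{T}_{d,k})$ of elements represented by a triple $(\psi,T,T')$ with $\psi$ acting by an element of $W(D)$ on each component (after identifying components with $\mathcal{T}_d$). $W_k(D)$ carries its profinite topology (pointwise level stabilizers form a basis of neighbourhoods of $1$), and $\mathrm{AAut}_D(\mathcal{T}_{d,k})$ carries the unique group topology making the inclusion of $W_k(D)$ continuous and open; it is totally disconnected and locally compact. Compact presentability. A locally compact group $G$ is compactly presented if it has a compact generating subset $S$ such that $G$ has a presentation, as an abstract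 group, with $S$ as set of generators and relators of bounded length. *)

(* Defs.v *)
From HB Require Import structures.
From mathcomp Require Import all_boot all_fingroup.
From mathcomp Require Import boolp classical_sets functions cardinality topology.

Set Implicit Arguments.
Unset Strict Implicit.
Unset Printing Implicit Defensive.

Local Open Scope classical_set_scope.

Record self_bij (X : Type) := SelfBij {
  bij_fun :> X -> X;
  bij_inv : X -> X;
  bij_funK : cancel bij_fun bij_inv;
  bij_invK : cancel bij_inv bij_fun }.

Lemma bijP X (f g : self_bij X) : f =1 g -> f = g.
Proof.
case: f g => [f f' fK f'K] [g g' gK g'K] /= /funext fg.
subst g; have fg' : f' = g' by apply/funext => x; rewrite -{1}[x]g'K fK.
by subst g'; congr SelfBij; apply: Prop_irrelevance.
Qed.

Section BijGroup.
Variable X : Type.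
Implicit Types f g h : self_bij X.

Definition bij_one : self_bij X := @SelfBij X id id (fun=> erefl) (fun=> erefl).
Definition bij_opp f : self_bij X := SelfBij (@bij_invK _ f) (@bij_funK _ f).
Definition bij_mul f g : self_bij X :=
  SelfBij (can_comp (@bij_funK _ f) (@bij_funK _ g))
      (can_comp (@bij_invK _ g) (@bij_invK _ f)).

Lemma bij_mulA : associative bij_mul.
Proof. by move=> f g h; apply: bijP. Qed.
Lemma bij_mul1 : left_id bij_one bij_mul.
Proof. by move=> f; apply: bijP. Qed.
Lemma bij_mulr1 : right_id bij_one bij_mul.
Proof. by move=> f; apply: bijP. Qed.
Lemma bij_mulV : left_inverse bij_one bij_opp bij_mul.
Proof. by move=> f; apply: bijP => x /=; rewrite bij_funK. Qed.
Lemma bij_mulrV : right_inverse bij_one bij_opp bij_mul.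
Proof. by move=> f; apply: bijP => x /=; rewrite bij_invK. Qed.

HB.instance Definition _ := gen_eqMixin (self_bij X).
HB.instance Definition _ := gen_choiceMixin (self_bij X).
HB.instance Definition _ :=
  isGroup.Build (self_bij X) bij_mulA bij_mul1 bij_mulr1 bij_mulV bij_mulrV.

Lemma bijV f : (f^-1%g : self_bij X) = bij_opp f. Proof. by []. Qed.
Lemma bijM f g : (f * g)%g = bij_mul f g. Proof. by []. Qed.
End BijGroup.

Record subgroup (G : groupType) := Subgroup {
  sg_set :> set G;
  sg_one : sg_set 1%g;
  sg_mul : forall x y, sg_set x -> sg_set y -> sg_set (x * y)%g;
  sg_inv : forall x, sg_set x -> sg_set x^-1%g }.

Definition sg_type (G : groupType) (H : subgroup G) : Type :=
  {x : G | x \in sg_set H}.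

Section SubgroupType.
Variables (G : groupType) (H : subgroup G).

HB.instance Definition _ := SubChoice.on (sg_type H).

Lemma sg_group_closed : group_closed (fun x : G => x \in sg_set H).
Proof.
split; first by rewrite unfold_in; apply/mem_set/sg_one.
move=> x y; rewrite !unfold_in => /set_mem Hx /set_mem Hy.
by apply/mem_set/sg_mul => //; apply: sg_inv.
Qed.

HB.instance Definition _ :=
  SubChoice_isSubGroup.Build G (fun x => x \in sg_set H) (sg_type H)
    sg_group_closed.

Definition sg_elt (x : G) (Hx : sg_set H x) : sg_type H := exist _ x (mem_set Hx).

Lemma sg_valP (x : sg_type H) : sg_set H (val x).
Proof. exact: set_mem (proj2_sig x). Qed.

Lemma sg_eltK x (Hx : sg_set H x) : val (sg_elt Hx) = x. Proof. by []. Qed.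

End SubgroupType.

HB.mixin Record isTopologicalGroup G & monoid.Group G & Topological G := {
  mulg_continuous : continuous (fun p : G * G => (p.1 * p.2)%g);
  invg_continuous : continuous (fun x : G => x^-1%g) }.

#[short(type="topGroupType")]
HB.structure Definition TopologicalGroup :=
  { G of monoid.Group G & Topological G & isTopologicalGroup G }.

Lemma mulg_continuous_l (G : topGroupType) (g : G) :
  continuous (fun x => (g * x)%g).
Proof.
move=> x A /= /(@mulg_continuous G (g, x)) [[B C] /= [Bg Cx] BCA].
apply: filterS Cx => y Cy; apply: (BCA (g, y)); split=> //.
exact: nbhs_singleton.
Qed.

(* Words over T and formal inverses: (x, true) is x and (x, false) is its
   inverse. *)
Definition gword (T : Type) := seq (T * bool).

Section Presentation.
Variables (G : groupType) (T : Type).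

Fixpoint gword_eval (v : T -> G) (w : gword T) : G :=
  if w is (x, b) :: w' then
    ((if b then v x else (v x)^-1) * gword_eval v w')%g
  else 1%g.

(* Equality of words in the group presented by < T | R >. *)
Inductive presented_eq (R : set (gword T)) : gword T -> gword T -> Prop :=
| Peq_refl w : presented_eq R w w
| Peq_sym w1 w2 : presented_eq R w1 w2 -> presented_eq R w2 w1
| Peq_trans w1 w2 w3 :
    presented_eq R w1 w2 -> presented_eq R w2 w3 -> presented_eq R w1 w3
| Peq_cat w1 w2 w1' w2' :
    presented_eq R w1 w1' -> presented_eq R w2 w2' ->
    presented_eq R (w1 ++ w2) (w1' ++ w2')
| Peq_cancel x b : presented_eq R [:: (x, b); (x, ~~ b)] [::]
| Peq_relator r : R r -> presented_eq R r [::].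

(* v : T -> G induces an isomorphism from < T | R > onto G. *)
Definition is_presentation (v : T -> G) (R : set (gword T)) :=
  (forall g : G, exists w, gword_eval v w = g) /\
  (forall w1 w2, gword_eval v w1 = gword_eval v w2 <-> presented_eq R w1 w2).

End Presentation.

Definition compactly_presented (G : topGroupType) :=
  locally_compact [set: G] /\
  exists S : set G, compact S /\
  exists (R : set (gword S)) (N : nat),
    (forall r, R r -> size r <= N) /\
    is_presentation (fun s : S => val s) R.

(* The topology in which the translates g U_n of a decreasing sequence of
   submonoids U_n form a neighbourhood basis of g. *)
Section CosetTopology.
Variables (G : groupType) (U : nat -> set G).
Hypothesis U1 : forall n, U n 1%g.
Hypothesis UM : forall n x y, U n x -> U n y -> U n (x * y)%g.
Hypothesis Uanti : forall m n, n <= m -> U m `<=` U n.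

Definition coset_nbhs (g : G) : set_system G :=
  [set A | exists n, forall u, U n u -> A (g * u)%g].

Lemma coset_nbhs_filter g : ProperFilter (coset_nbhs g).
Proof.
apply: Build_ProperFilter_ex.
  by move=> A [n An]; exists (g * 1)%g; apply: An.
split; first by exists 0.
  move=> A B [n An] [m Bm]; exists (maxn n m) => u Uu; split.
    by apply/An/(Uanti (leq_maxl n m)).
  by apply/Bm/(Uanti (leq_maxr n m)).
by move=> A B AB [n An]; exists n => u /An /AB.
Qed.

Lemma coset_nbhs_singleton g A : coset_nbhs g A -> A g.
Proof. by move=> [n /(_ 1%g (U1 n))]; rewrite mulg1. Qed.

Lemma coset_nbhs_nbhs g A :
  coset_nbhs g A -> coset_nbhs g (fun h => coset_nbhs h A).
Proof.
move=> [n An]; exists n => u Uu; exists n => v Uv.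
by rewrite -mulgA; apply/An/UM.
Qed.
End CosetTopology.

Record rtree := RTree {
  vertex :> Type;
  troot : vertex;
  child : vertex -> vertex -> Prop;
  level : vertex -> nat;
  level_root : level troot = 0;
  level_child : forall u v, child u v -> level v = (level u).+1;
  child_inj : forall u u' v, child u v -> child u' v -> u = u';
  child_ex : forall v, v = troot \/ exists u, child u v }.

Arguments troot {_}.
Arguments child {_}.
Arguments level {_}.

Definition adjacent (T : rtree) (u v : T) := child u v \/ child v u.

Definition is_tree_aut (T : rtree) (f : self_bij T) :=
  f troot = troot /\ forall u v, adjacent (f u) (f v) <-> adjacent u v.

Section TreeAut.
Variable T : rtree.
Implicit Types f g : self_bij T.

Lemma is_tree_aut1 : is_tree_aut (1%g : self_bij T).
Proof. by []. Qed.

Lemma is_tree_autM f g :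
  is_tree_aut f -> is_tree_aut g -> is_tree_aut (f * g)%g.
Proof.
move=> [f0 fa] [g0 ga]; split=> [|u v]; first by rewrite /= g0.
by rewrite /= fa ga.
Qed.

Lemma is_tree_autV f : is_tree_aut f -> is_tree_aut f^-1%g.
Proof.
move=> [f0 fa]; split=> [|u v]; first by rewrite -{1}f0 /= bij_funK.
by rewrite -fa /= !bij_invK.
Qed.

Definition tree_aut_sg : subgroup (self_bij T) :=
  Subgroup is_tree_aut1 is_tree_autM is_tree_autV.

Definition tree_aut := sg_type tree_aut_sg.
HB.instance Definition _ := monoid.Group.on tree_aut.

Definition aut_fun (f : tree_aut) : T -> T := val f.

Definition level_stab (n : nat) : set tree_aut :=
  [set f | forall v, level v <= n -> aut_fun f v = v].

End TreeAut.
Coercion aut_fun : tree_aut >-> Funclass.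

Section TreeAutTheory.
Variable T : rtree.
Implicit Types f g : tree_aut T.

Lemma autP f g : f =1 g -> f = g.
Proof. by move=> fg; apply/val_inj/bijP. Qed.
Lemma aut1E (v : T) : aut_fun (1%g : tree_aut T) v = v. Proof. by []. Qed.
Lemma autME f g v : aut_fun (f * g)%g v = f (g v). Proof. by []. Qed.
Lemma autK f : cancel f (aut_fun f^-1%g).
Proof. by move=> v; rewrite -autME mulVg. Qed.
Lemma autVK f : cancel (aut_fun f^-1%g) f.
Proof. by move=> v; rewrite -autME mulgV. Qed.
Lemma aut_inj f : injective f. Proof. exact: can_inj (autK f). Qed.
Lemma aut_root f : f troot = troot.
Proof. by case: (sg_valP f). Qed.
Lemma aut_adj f u v : adjacent (f u) (f v) <-> adjacent u v.
Proof. by case: (sg_valP f) => _; apply. Qed.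

Lemma aut_child f u v : child u v -> child (f u) (f v).
Proof.
have [n] := ubnP (level u); elim: n u v => // n IHn u v lun uv.
have: adjacent (f u) (f v) by apply/aut_adj; left.
case=> // fvu.
case: (child_ex u) => [u0|[w wu]].
  by move: (level_child fvu); rewrite {1}u0 aut_root level_root.
have fwu : child (f w) (f u) by apply: IHn => //; rewrite -(level_child wu).
have /aut_inj vw := child_inj fvu fwu.
by move: (level_child wu); rewrite -vw (level_child uv) => /eqP; rewrite -addn2 -{1}[level u]addn0 eqn_add2l.
Qed.

Lemma aut_childE f u v : child (f u) (f v) <-> child u v.
Proof.
split; last exact: aut_child.
by move/(aut_child f^-1%g); rewrite !autK.
Qed.

Lemma aut_level f v : level (f v) = level v.
Proof.
have [n] := ubnP (level v); elim: n v => // n IHn v lvn.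
case: (child_ex v) => [->|[w wv]]; first by rewrite aut_root.
rewrite (level_child wv) (level_child (aut_child f wv)) IHn //.
by rewrite -ltnS -(level_child wv).
Qed.

Lemma is_tree_aut_child (f : self_bij T) :
  f troot = troot -> (forall u v, child u v -> child (f u) (f v)) ->
  (forall u v, child u v -> child (bij_inv f u) (bij_inv f v)) ->
  is_tree_aut f.
Proof.
move=> f0 fc fc'; split=> // u v; split; last by case=> /fc; [left|right].
by case=> /fc'; rewrite !bij_funK; [left|right].
Qed.

Lemma mk_aut_subproof (f f' : T -> T) (fK : cancel f f') (f'K : cancel f' f) :
  f troot = troot -> (forall u v, child u v -> child (f u) (f v)) ->
  (forall u v, child u v -> child (f' u) (f' v)) ->
  is_tree_aut (SelfBij fK f'K).
Proof. by move=> f0 fc f'c; apply: is_tree_aut_child. Qed.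

Definition mk_aut (f f' : T -> T) (fK : cancel f f') (f'K : cancel f' f)
    (f0 : f troot = troot) (fc : forall u v, child u v -> child (f u) (f v))
    (f'c : forall u v, child u v -> child (f' u) (f' v)) : tree_aut T :=
  sg_elt (H := tree_aut_sg T) (mk_aut_subproof fK f'K f0 fc f'c).

Lemma level_stab1 n : level_stab n (1%g : tree_aut T). Proof. by []. Qed.
Lemma level_stabM n f g :
  level_stab n f -> level_stab n g -> level_stab n (f * g)%g.
Proof. by move=> fn gn v vn; rewrite autME gn // fn. Qed.
Lemma level_stabV n f : level_stab n f -> level_stab n f^-1%g.
Proof. by move=> fn v vn; rewrite -{1}(fn v vn) autK. Qed.
Lemma level_stab_anti m n : n <= m -> level_stab m `<=` @level_stab T n.
Proof. by move=> nm f fm v vn; apply/fm/(leq_trans vn). Qed.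

HB.instance Definition _ :=
  hasNbhs.Build (tree_aut T) (coset_nbhs (@level_stab T)).
HB.instance Definition _ := Nbhs_isNbhsTopological.Build (tree_aut T)
  (coset_nbhs_filter level_stab1 level_stab_anti)
  (coset_nbhs_singleton level_stab1) (coset_nbhs_nbhs level_stabM).

Lemma tree_aut_nbhsE f (A : set (tree_aut T)) :
  nbhs f A = exists n, forall u, level_stab n u -> A (f * u)%g.
Proof. by []. Qed.

End TreeAutTheory.

(* T_d: a vertex is a word over B = 'I_d. *)
Section RegularTree.
Variable d : nat.

Definition td_child (u v : seq 'I_d) := exists x, v = rcons u x.

Lemma td_level_child u v : td_child u v -> size v = (size u).+1.
Proof. by move=> [x ->]; rewrite size_rcons. Qed.
Lemma td_child_inj u u' v : td_child u v -> td_child u' v -> u = u'.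
Proof. by move=> [x ->] [y /rcons_inj[]]. Qed.
Lemma td_child_ex v : v = [::] \/ exists u, td_child u v.
Proof. by case/lastP: v => [|u x]; [left|right; exists u, x]. Qed.

Definition Td : rtree :=
  RTree (erefl : size [::] = 0) td_level_child td_child_inj td_child_ex.
End RegularTree.

(* T_(d,k): None is the root, Some (a, [:: b1; ..; bn]) is the vertex
   a b1 .. bn. *)
Definition node (k d : nat) : Type := ('I_k * seq 'I_d)%type.

Section KTree.
Variables k d : nat.

Definition tdk_child (u v : option (node k d)) :=
  match u with
  | None => exists a, v = Some (a, [::])
  | Some (a, w) => exists x, v = Some (a, rcons w x)
  end.

Definition tdk_level (v : option (node k d)) :=
  if v is Some (_, w) then (size w).+1 else 0.

Lemma tdk_level_child u v : tdk_child u v -> tdk_level v = (tdk_level u).+1.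
Proof. by case: u => [[a w]|] [x ->] //=; rewrite size_rcons. Qed.
Lemma tdk_child_inj u u' v : tdk_child u v -> tdk_child u' v -> u = u'.
Proof.
case: u u' => [[a w]|] [[a' w']|] [x ->] [y] //.
- by case=> <- /rcons_inj[<-].
- by case=> _; case: (w).
- by case=> _; case: (w').
Qed.
Lemma tdk_child_ex v : v = None \/ exists u, tdk_child u v.
Proof.
case: v => [[a w]|]; [right|by left].
case/lastP: w => [|u x]; first by exists None, a.
by exists (Some (a, u)), x.
Qed.

Definition Tdk : rtree :=
  RTree (erefl : tdk_level None = 0) tdk_level_child tdk_child_inj tdk_child_ex.
End KTree.

Section WD.
Variables (d : nat) (D : {group 'S_d}).
Implicit Types (g h : tree_aut (Td d)) (s : 'S_d) (v w : seq 'I_d).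

Definition local_perm g v s :=
  forall x, g (rcons v x) = rcons (g v : seq 'I_d) (s x).

Definition Dn (n : nat) : set (tree_aut (Td d)) :=
  [set g | forall v, exists2 s,
     (if size v < n then s \in D else s == 1%g) & local_perm g v s].

(* W(D) is the smallest closed subgroup containing D_1, D_2, .. *)
Definition WD_set : set (tree_aut (Td d)) :=
  [set g | forall H : subgroup (tree_aut (Td d)),
     closed (sg_set H) -> (forall n, 0 < n -> Dn n `<=` sg_set H) ->
     sg_set H g].

Definition WD : subgroup (tree_aut (Td d)).
Proof.
refine (@Subgroup _ WD_set _ _ _).
- by move=> H _ _; apply: sg_one.
- by move=> x y Hx Hy H cH DH; apply: sg_mul; [exact: Hx|exact: Hy].
- by move=> x Hx H cH DH; apply: sg_inv; exact: Hx.
Defined.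

Let Wloc_set : set (tree_aut (Td d)) :=
  [set g | forall v, exists2 s, s \in D & local_perm g v s].

Lemma local_permM g h v s t :
  local_perm h v s -> local_perm g (h v) t ->
  local_perm (g * h : tree_aut (Td d))%g v (s * t)%g.
Proof. by move=> hs gt x; rewrite !autME hs gt permM. Qed.

Lemma local_permV g v s :
  local_perm g v s -> local_perm g^-1%g (g v) s^-1%g.
Proof.
by move=> gs x; rewrite autK; apply: (@aut_inj _ g); rewrite autVK gs permKV.
Qed.

Let Wloc1 : Wloc_set 1%g.
Proof. by move=> v; exists 1%g => // x; rewrite !aut1E perm1. Qed.
Let WlocM x y : Wloc_set x -> Wloc_set y -> Wloc_set (x * y)%g.
Proof.
move=> Wx Wy v; case: (Wy v) => s Ds ys; case: (Wx (y v)) => t Dt xt.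
by exists (s * t)%g; [exact: groupM|exact: local_permM].
Qed.
Let WlocV x : Wloc_set x -> Wloc_set x^-1%g.
Proof.
move=> Wx v; case: (Wx (aut_fun x^-1%g v)) => s Ds xs.
exists s^-1%g; first by rewrite groupV.
by rewrite -[v](autVK x); apply: local_permV.
Qed.

Let trunc n g v : seq 'I_d := (g (take n v) : seq 'I_d) ++ drop n v.

Lemma td_size g v : size (g v : seq 'I_d) = size v.
Proof. exact: (aut_level g). Qed.

Lemma td_rcons g v x : exists y, g (rcons v x) = rcons (g v : seq 'I_d) y.
Proof. by apply: (@aut_child _ g v); exists x. Qed.

Lemma td_nil g : g [::] = [::].
Proof. exact: aut_root. Qed.

Let trunc_small n g v : size v <= n -> trunc n g v = g v.
Proof. by move=> vn; rewrite /trunc take_oversize // drop_oversize // cats0. Qed.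

Let take_trunc n g v : take n (trunc n g v) = g (take n v).
Proof.
have [nv|vn] := leqP n (size v).
  by rewrite take_size_cat // td_size size_takel.
by rewrite trunc_small 1?ltnW // !take_oversize ?td_size // ltnW.
Qed.

Let drop_trunc n g v : drop n (trunc n g v) = drop n v.
Proof.
have [nv|vn] := leqP n (size v).
  by rewrite drop_size_cat // td_size size_takel.
by rewrite trunc_small 1?ltnW // !drop_oversize ?td_size // ltnW.
Qed.

Let truncK n g : cancel (trunc n g) (trunc n g^-1%g).
Proof.
by move=> v; rewrite {1}/trunc take_trunc drop_trunc autK cat_take_drop.
Qed.
Let truncVK n g : cancel (trunc n g^-1%g) (trunc n g).
Proof. by move=> v; rewrite {1}/trunc take_trunc drop_trunc autVK cat_take_drop. Qed.

Let take_rcons_small n v x : size v < n -> take n (rcons v x) = rcons v x.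
Proof. by move=> vn; rewrite take_oversize // size_rcons. Qed.

Let trunc_big n g v x : n <= size v ->
  trunc n g (rcons v x) = rcons (trunc n g v) x.
Proof.
move=> nv; rewrite /trunc -[rcons v x]cats1 takel_cat // drop_cat.
case: ltnP => [_|vn]; first by rewrite catA cats1.
have -> : n = size v by apply/eqP; rewrite eqn_leq nv.
by rewrite subnn drop0 take_size drop_size cats0 cats1.
Qed.

Let trunc_child n g v w : td_child v w -> td_child (trunc n g v) (trunc n g w).
Proof.
move=> [x ->]; have [nv|vn] := leqP n (size v).
  by exists x; rewrite trunc_big.
rewrite !trunc_small ?size_rcons // 1?ltnW //.
by have [y ->] := td_rcons g v x; exists y.
Qed.

Let trunc_nil n g : trunc n g [::] = [::].
Proof. by rewrite trunc_small // td_nil. Qed.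

Let trunc_aut (n : nat) g : tree_aut (Td d) :=
  @mk_aut (Td d) _ _ (@truncK n g) (@truncVK n g) (trunc_nil n g)
    (@trunc_child n g) (@trunc_child n g^-1%g).

Lemma WDP g : sg_set WD g <-> forall v, exists2 s, s \in D & local_perm g v s.
Proof.
split=> [Wg|Wg H Hc HD].
  apply: (Wg (Subgroup Wloc1 WlocM WlocV)) => /=; last first.
    move=> n n0 h Dh v; case: (Dh v) => s; case: ltnP => [_ Ds|_ /eqP ->] hs.
      by exists s.
    by exists 1%g.
  move=> h hcl v.
  have [|h' [Wh' [u su h'E]]] :=
    hcl [set f | exists2 u, level_stab (size v).+1 u & f = (h * u)%g].
    by rewrite tree_aut_nbhsE; exists (size v).+1 => u su /=; exists u.
  case: (Wh' v) => s Ds h's; exists s => // x.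
  move: (h's x); rewrite h'E !autME (su v) ?leqnSn // (su (rcons v x)) //.
  by rewrite /= size_rcons.
apply: Hc; rewrite /closure /= => B; rewrite tree_aut_nbhsE => -[n Bn].
exists (trunc_aut n.+1 g); split.
  apply: (HD n.+1) => // v; case: (Wg v) => s Ds gs.
  case: (ltnP (size v) n.+1) => [vn|nv]; last first.
    by exists 1%g => // x; rewrite perm1; apply: trunc_big.
  exists s => // x; rewrite /aut_fun /= !trunc_small ?size_rcons //.
  exact: ltnW.
rewrite -[trunc_aut _ _](mulKVg g); apply: Bn => v vn.
have Ev : aut_fun (trunc_aut n.+1 g) v = g v.
  by apply: trunc_small; apply: leqW.
by rewrite autME Ev autK.
Qed.

Lemma take_aut g v w : take (size v) (g (v ++ w) : seq 'I_d) = g v.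
Proof.
elim/last_ind: w => [|w x IHw]; first by rewrite cats0 take_oversize // td_size.
rewrite -rcons_cat; have [y ->] := td_rcons g (v ++ w) x.
by rewrite -cats1 takel_cat // td_size size_cat leq_addr.
Qed.

Lemma WD_section g v : sg_set WD g ->
  exists2 h : tree_aut (Td d), sg_set WD h &
    forall w, g (v ++ w) = (g v : seq 'I_d) ++ h w.
Proof.
move=> Wg.
pose s (f : tree_aut (Td d)) u w := drop (size u) (f (u ++ w) : seq 'I_d).
have sE (f : tree_aut (Td d)) u w : f (u ++ w) = (f u : seq 'I_d) ++ s f u w.
  by rewrite -{1}(take_aut f u w) cat_take_drop.
have sK (f : tree_aut (Td d)) u : cancel (s f u) (s f^-1%g (f u)).
  by move=> w; rewrite {1}/s -sE autK td_size drop_size_cat.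
have sVK : cancel (s g^-1%g (g v)) (s g v).
  by have := sK g^-1%g (g v); rewrite invgK autK.
have sc (f : tree_aut (Td d)) u x y : td_child x y -> td_child (s f u x) (s f u y).
  move=> [z ->]; rewrite /s -rcons_cat.
  have [t ->] := td_rcons f (u ++ x) z; exists t.
  by rewrite drop_rcons // td_size size_cat leq_addr.
have s0 : s g v [::] = [::].
  by rewrite /s cats0 drop_oversize // td_size.
exists (@mk_aut (Td d) _ _ (sK g v) sVK s0 (sc g v) (sc g^-1%g (g v))); last first.
  by move=> w; apply: sE.
apply/WDP => w; move/WDP: Wg => /(_ (v ++ w)) [p Dp gp]; exists p => // x.
rewrite /aut_fun /= /s -rcons_cat gp drop_rcons // td_size size_cat leq_addr //.
Qed.

End WD.

Section WDGlue.
Variables (d : nat) (D : {group 'S_d}).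

Lemma WD_glue (N : nat) (s : seq 'I_d -> tree_aut (Td d)) :
  (forall u, sg_set (WD D) (s u)) ->
  exists2 h : tree_aut (Td d), sg_set (WD D) h &
    forall w, h w = take N w ++ (s (take N w) (drop N w) : seq 'I_d).
Proof.
move=> Ws.
pose f (t : seq 'I_d -> tree_aut (Td d)) w :=
  take N w ++ (t (take N w) (drop N w) : seq 'I_d).
have sz t w : size (f t w) = size w.
  by rewrite size_cat td_size -size_cat cat_take_drop.
have takef t w : take N (f t w) = take N w.
  have [Nw|wN] := leqP N (size w).
    by rewrite take_size_cat // size_takel.
  by rewrite /f drop_oversize ?td_nil ?cats0 ?take_oversize // ltnW.
have dropf t w : drop N (f t w) = t (take N w) (drop N w).
  have [Nw|wN] := leqP N (size w).
    by rewrite drop_size_cat // size_takel.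
  rewrite drop_oversize ?sz 1?ltnW // drop_oversize ?td_nil // ltnW //.
pose s' u := (s u)^-1%g.
have fK : cancel (f s) (f s').
  by move=> w; rewrite {1}/f takef dropf /s' autK cat_take_drop.
have fVK : cancel (f s') (f s).
  by move=> w; rewrite {1}/f takef dropf /s' autVK cat_take_drop.
have f0 : f s [::] = [::] by rewrite /f /= td_nil.
have small t w : size w <= N -> f t w = w.
  by move=> wN; rewrite /f drop_oversize // td_nil cats0 take_oversize.
have big t w x : N <= size w ->
    f t (rcons w x) = take N w ++ (t (take N w) (rcons (drop N w) x) : seq 'I_d).
  by move=> Nw; rewrite /f drop_rcons // -cats1 takel_cat.
have fc t u v : td_child u v -> td_child (f t u) (f t v).
  move=> [x ->]; have [Nu|uN] := leqP N (size u); last first.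
    by exists x; rewrite !small ?size_rcons // ltnW.
  rewrite big //; have [y ->] := td_rcons (t (take N u)) (drop N u) x.
  by exists y; rewrite -rcons_cat.
exists (@mk_aut (Td d) _ _ fK fVK f0 (fc s) (fc s')) => //.
apply/WDP => v; have [Nv|vN] := leqP N (size v); last first.
  by exists 1%g => // x; rewrite perm1 /aut_fun /= !small ?size_rcons // ltnW.
have /WDP/(_ (drop N v)) [p Dp sp] := Ws (take N v).
by exists p => // x; rewrite /aut_fun /= big // sp /f rcons_cat.
Qed.
End WDGlue.

(* The ray of vertices root, a, a b0, a b0 b1, .. is the pair (a, b). *)
Definition ray (k d : nat) : Type :=
  (discrete_topology 'I_k * {ptws nat -> discrete_topology 'I_d})%type.
HB.instance Definition _ k d := Topological.on (ray k d).

Section Boundary.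
Variables k d : nat.
Implicit Types (r : ray k d) (v : node k d) (w : seq 'I_d) (b : nat -> 'I_d).

Definition ray_vertex r (n : nat) : Tdk k d :=
  if n is m.+1 then Some (r.1, mkseq r.2 m) else None.

Definition on_ray (u : Tdk k d) r := exists n, u = ray_vertex r n.

Definition catr w b : nat -> 'I_d := fun n => nth (b (n - size w)) w n.

Lemma mkseq_catr w b n : mkseq (catr w b) (size w + n) = w ++ mkseq b n.
Proof.
apply: (@eq_from_nth _ (b 0)); rewrite ?size_cat ?size_mkseq // => i iwn.
rewrite nth_mkseq // nth_cat /catr; case: ltnP => [iw|wi].
  exact: set_nth_default.
by rewrite nth_default // nth_mkseq // ltn_subLR.
Qed.

Lemma mkseq_catr_take w b n : n <= size w -> mkseq (catr w b) n = take n w.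
Proof.
move=> nw; apply: (@eq_from_nth _ (b 0)); rewrite ?size_mkseq ?size_takel //.
move=> i lin; rewrite nth_mkseq // nth_take // /catr.
by apply/set_nth_default/(leq_trans lin).
Qed.

Lemma catr_cat w1 w2 b : catr (w1 ++ w2) b = catr w1 (catr w2 b).
Proof.
apply/funext => n; rewrite /catr nth_cat size_cat subnDA.
by case: ltnP => [nw|wn]; [exact: set_nth_default|rewrite [RHS]nth_default].
Qed.

Lemma catr0 b : catr [::] b = b.
Proof. by apply/funext => n; rewrite /catr nth_nil subn0. Qed.

Lemma mkseq_inj b b' : (forall n, mkseq b n = mkseq b' n) -> b = b'.
Proof.
move=> bb'; apply/funext => n; move: (bb' n.+1).
by rewrite !mkseqS => /rcons_inj[].
Qed.

Lemma catr_inj w w' b b' : size w = size w' -> catr w b = catr w' b' ->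
  w = w' /\ b = b'.
Proof.
move=> ww' E; have {}E n : w ++ mkseq b n = w' ++ mkseq b' n.
  by rewrite -!mkseq_catr ww' E.
split; first by have := E 0; rewrite /mkseq /= !cats0.
apply: mkseq_inj => n; have /eqP := E n.
by rewrite eqseq_cat // => /andP[_ /eqP].
Qed.

Lemma catr_split b n : b = catr (mkseq b n) (fun i => b (n + i)).
Proof.
apply: mkseq_inj => m; have [mn|/ltnW nm] := leqP m n.
  by rewrite mkseq_catr_take ?size_mkseq // /mkseq -map_take take_iota (minn_idPl mn).
have := mkseq_catr (mkseq b n) (fun i => b (n + i)) (m - n).
rewrite size_mkseq subnKC // => ->.
apply: (@eq_from_nth _ (b 0)); rewrite ?size_cat !size_mkseq ?subnKC // => i im.
rewrite nth_mkseq // nth_cat size_mkseq; case: ltnP => [i_n|ni].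
  by rewrite nth_mkseq.
by rewrite nth_mkseq ?subnKC // ltn_sub2rE.
Qed.

Definition ray_act (g : tree_aut (Td d)) b : nat -> 'I_d :=
  fun n => last (b n) (g (mkseq b n.+1) : seq 'I_d).

Lemma mkseq_ray_act (g : tree_aut (Td d)) b n : mkseq (ray_act g b) n = g (mkseq b n).
Proof.
elim: n => [|n IHn]; first by rewrite /mkseq /= td_nil.
rewrite mkseqS IHn /ray_act mkseqS; have [y ->] := td_rcons g (mkseq b n) (b n).
by rewrite last_rcons.
Qed.

Lemma ray_act1 b : ray_act 1%g b = b.
Proof. by apply: mkseq_inj => n; rewrite mkseq_ray_act. Qed.
Lemma ray_actM g h b : ray_act (g * h)%g b = ray_act g (ray_act h b).
Proof. by apply: mkseq_inj => n; rewrite !mkseq_ray_act. Qed.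
Lemma ray_actK g : cancel (ray_act g) (ray_act g^-1%g).
Proof. by move=> b; rewrite -ray_actM mulVg ray_act1. Qed.
Lemma ray_actVK g : cancel (ray_act g^-1%g) (ray_act g).
Proof. by move=> b; rewrite -ray_actM mulgV ray_act1. Qed.

Lemma ray_act_catr (g h : tree_aut (Td d)) w b :
  (forall u, g (w ++ u) = (g w : seq 'I_d) ++ h u) ->
  ray_act g (catr w b) = catr (g w : seq 'I_d) (ray_act h b).
Proof.
move=> gh; apply: mkseq_inj => n; rewrite mkseq_ray_act.
have [nw|/ltnW wn] := leqP n (size w).
  rewrite mkseq_catr_take // mkseq_catr_take ?td_size //.
  by have := take_aut g (take n w) (drop n w); rewrite cat_take_drop size_takel.
rewrite -(subnKC wn) mkseq_catr gh -{2}(td_size g w) mkseq_catr.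
by rewrite mkseq_ray_act.
Qed.

(* A finite rooted complete subtree, given by its set of vertices: a subtree
   (closed under taking parents) in which every vertex which is the root or has
   a child in T has all its children in T. *)
Record complete_subtree (T : set (Tdk k d)) : Prop := {
  cst_finite : finite_set T;
  cst_root : T troot;
  cst_parent : forall u v : Tdk k d, child u v -> T v -> T u;
  cst_root_children : forall v : Tdk k d, child troot v -> T v;
  cst_children : forall u v v' : Tdk k d, child u v -> T v -> child u v' -> T v' }.

Definition leaf (T : set (Tdk k d)) (v : node k d) :=
  T (Some v) /\ forall u : Tdk k d, child (Some v : Tdk k d) u -> ~ T u.

(* w, a vertex of T_d, as a vertex of the subtree rooted at v. *)
Definition node_cat v w : Tdk k d := Some (v.1, v.2 ++ w).

(* psi restricts to an isomorphism from the forest T_(d,k) \ T onto T_(d,k) \ T'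
   acting by an element of W on each component; its values elsewhere are
   irrelevant. The second conjunct is the bijection between components, so T
   and T' have the same number of leaves. *)
Definition forest_iso (W : set (tree_aut (Td d))) (T T' : set (Tdk k d))
    (psi : Tdk k d -> Tdk k d) :=
  (forall v, leaf T v -> exists v', leaf T' v' /\
     exists2 g : tree_aut (Td d), W g &
       forall w, psi (node_cat v w) = node_cat v' (g w)) /\
  (forall v', leaf T' v' -> exists! v, leaf T v /\ psi (Some v) = Some v').

Definition induced_by (T : set (Tdk k d)) (psi : Tdk k d -> Tdk k d)
    (f : ray k d -> ray k d) :=
  forall v w r, leaf T v -> on_ray (node_cat v w) r ->
    on_ray (psi (node_cat v w)) (f r).

Definition homeo (f : self_bij (ray k d)) :=
  continuous f /\ continuous (bij_inv f).

(* AAut(T_(d,k)) is the case W = setT. *)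
Definition almost_aut (W : set (tree_aut (Td d))) : set (self_bij (ray k d)) :=
  [set f | homeo f /\ exists T T' psi,
    [/\ complete_subtree T, complete_subtree T', forest_iso W T T' psi &
        induced_by T psi f]].

(* The elements of Aut(T_d) ray_act on the boundary by shifting prefixes; this is
   the form in which membership in almost_aut is used below. *)
Definition piecewise (W : set (tree_aut (Td d))) (f : self_bij (ray k d)) :=
  exists N, forall a w, size w = N ->
    exists a' w', exists2 g : tree_aut (Td d), W g &
      forall b, f (a, catr w b) = (a', catr w' (ray_act g b)).

Lemma on_rayP a w r : on_ray (Some (a, w)) r <->
  r.1 = a /\ mkseq r.2 (size w) = w.
Proof.
split=> [[[|n] //= [-> ->]]|[ra rw]]; first by rewrite size_mkseq.
by exists (size w).+1; rewrite /= ra rw.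
Qed.

Lemma forest_iso_piece (T : set (Tdk k d)) psi (f : self_bij (ray k d)) v v'
    (g : tree_aut (Td d)) :
  leaf T v -> (forall w, psi (node_cat v w) = node_cat v' (g w)) ->
  induced_by T psi f ->
  forall b, f (v.1, catr v.2 b) = (v'.1, catr v'.2 (ray_act g b)).
Proof.
move=> vT psig fpsi b; set r := (v.1, _).
have H n : (f r).1 = v'.1 /\
    mkseq (f r).2 (size v'.2 + n) = v'.2 ++ mkseq (ray_act g b) n.
  have /on_rayP : on_ray (node_cat v' (g (mkseq b n))) (f r).
    rewrite -psig; apply: fpsi => //; apply/on_rayP; split=> //=.
    by rewrite size_cat size_mkseq mkseq_catr.
  by rewrite size_cat td_size size_mkseq mkseq_ray_act.
case: (f r) H => /= a c H; congr pair; first by case: (H 0).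
rewrite [LHS](catr_split _ (size v'.2)).
have [_] := H 0; rewrite addn0 /mkseq /= cats0 -/(mkseq c _) => cv'.
have -> : mkseq c (size v'.2) = v'.2 by [].
congr catr; apply: mkseq_inj => n; have [_ /eqP] := H n.
rewrite [X in mkseq X _](catr_split c (size v'.2)) -/(mkseq c _).
rewrite (_ : mkseq c (size v'.2) = v'.2) // mkseq_catr.
by rewrite eqseq_cat // => /andP[_ /eqP].
Qed.

End Boundary.

Section AlmostAutGroup.
Variables k d : nat.
Implicit Types (r : ray k d) (v : node k d) (w : seq 'I_d) (b : nat -> 'I_d).

Lemma finite_level n : finite_set [set u : Tdk k d | level u <= n].
Proof.
pose F (p : option ('I_k * n.-bseq 'I_d)) : Tdk k d :=
  if p is Some (a, s) then Some (a, val s) else None.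
apply: (@sub_finite_set _ _ (range F)); last exact/finite_image/finite_finset.
move=> [[a w]|] /= un; last by exists None.
have wn : size w <= n by apply: ltnW.
by exists (Some (a, Bseq wn)).
Qed.

Lemma finite_level_bound (T : set (Tdk k d)) :
  finite_set T -> exists M, forall u, T u -> level u <= M.
Proof.
move=> /finite_seqP[s ->]; exists (\max_(u <- s) @level (Tdk k d) u) => u /= us.
by apply: leq_bigmax_seq.
Qed.

Lemma node_bound N (F : node k d -> nat) :
  exists M, forall v, size v.2 = N -> F v <= M.
Proof.
exists (\max_(p : 'I_k * N.-tuple 'I_d) F (p.1, val p.2)) => -[a w] /= wN.
have wN' : size w == N by apply/eqP.
exact: (@leq_bigmax _ (fun p : 'I_k * N.-tuple 'I_d => F (p.1, val p.2))
  (a, Tuple wN')).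
Qed.

Lemma leaf_below (T : set (Tdk k d)) : complete_subtree T ->
  exists N, forall v, size v.2 = N ->
    exists u w, leaf T u /\ v = (u.1, u.2 ++ w).
Proof.
move=> cT; have [M TM] := finite_level_bound (cst_finite cT).
exists M => -[a w] /= wM; apply: contrapT => nleaf.
have H n : n <= size w -> T (Some (a, take n w)).
  elim: n => [_|n IHn nw].
    by rewrite take0; apply: (cst_root_children cT); exists a.
  have Tn := IHn (ltnW nw); apply: contrapT => Tn1; apply: nleaf.
  exists (a, take n w), (drop n w); split; last by rewrite /= cat_take_drop.
  split=> // u uc Tu; apply: Tn1; apply: (cst_children cT uc Tu).
  have x0 : 'I_d by case: (w) nw.
  by exists (nth x0 w n); rewrite -take_nth.
have := TM _ (H _ (leqnn _)); rewrite take_size /= wM.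
by rewrite ltnn.
Qed.

Lemma ball_complete n :
  complete_subtree [set u : Tdk k d | level u <= n.+1].
Proof.
split=> [|//||v [a ->] //|u v v' uv].
- exact: finite_level.
- move=> u v uv Tv; have : level v <= n.+1 := Tv.
  by rewrite (level_child uv) => /ltnW.
- move=> Tv uv'; have : level v <= n.+1 := Tv.
  by rewrite (level_child uv) -(level_child uv').
Qed.

Lemma almost_aut1 (W : set (tree_aut (Td d))) : W 1%g ->
  almost_aut W (1%g : self_bij (ray k d)).
Proof.
move=> W1; split; first by split=> r; apply: cvg_id.
exists [set u : Tdk k d | level u <= 1], [set u : Tdk k d | level u <= 1], id.
split=> //; [exact: ball_complete|exact: ball_complete|].
split=> [v vT|v vT]; first by exists v; split=> //; exists 1%g.
by exists v; split=> // u [_ []].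
Qed.

Section WithD.
Variable D : {group 'S_d}.
Notation W := (sg_set (WD D)).
Implicit Type f : self_bij (ray k d).

Lemma almost_aut_piecewise f : almost_aut W f -> piecewise W f.
Proof.
move=> [_ [T [T' [psi [cT cT' [iso _] find]]]]].
have [N HN] := leaf_below cT; exists N => a w wN.
have [u [t [uT [-> ->]]]] := HN (a, w) wN.
have [v' [_ [g Wg psig]]] := iso u uT.
have [h Wh gh] := WD_section t Wg.
exists v'.1, (v'.2 ++ (g t : seq 'I_d)), h => // b.
by rewrite catr_cat (forest_iso_piece uT psig find) (ray_act_catr _ gh) catr_cat.
Qed.

Lemma piece_choice f N :
  (forall a w, size w = N ->
    exists a' w', exists2 g : tree_aut (Td d), W g &
      forall b, f (a, catr w b) = (a', catr w' (ray_act g b))) ->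
  {Q : node k d -> node k d * tree_aut (Td d) & forall v,
    size v.2 = N -> W (Q v).2 /\ forall b,
      f (v.1, catr v.2 b) = ((Q v).1.1, catr (Q v).1.2 (ray_act (Q v).2 b))}.
Proof.
move=> fN.
apply: (@choice _ _ (fun (v : node k d) (p : node k d * tree_aut (Td d)) =>
  size v.2 = N -> W p.2 /\ forall b,
    f (v.1, catr v.2 b) = (p.1.1, catr p.1.2 (ray_act p.2 b)))) => v.
have [vN|vN] := pselect (size v.2 = N); last by exists (v, 1%g) => /vN.
have [a' [w' [g Wg fg]]] := fN v.1 v.2 vN.
by exists ((a', w'), g).
Qed.

Lemma piecewise_almost_aut f : homeo f -> piecewise W f -> almost_aut W f.
Proof.
move=> hf [N fN].
have [[r0]|nray] := pselect (inhabited (ray k d)); last first.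
  rewrite (_ : f = 1%g); first exact: almost_aut1 (sg_one (WD D)).
  by apply: bijP => r; case: nray.
have b0 : nat -> 'I_d := r0.2.
have {fN} [Q HQ] := piece_choice fN.
pose q v := (Q v).1.
have fq v b : size v.2 = N ->
    f (v.1, catr v.2 b) = ((q v).1, catr (q v).2 (ray_act (Q v).2 b)).
  by move=> vN; have [_ ->] := HQ v vN.
have qdisj v v' t : size v.2 = N -> size v'.2 = N -> (q v').1 = (q v).1 ->
    (q v').2 = (q v).2 ++ t -> v = v'.
  move=> vN v'N q1 q2.
  have E : f (v'.1, catr v'.2 b0) = f (v.1, catr v.2
      (ray_act (Q v).2^-1%g (catr t (ray_act (Q v').2 b0)))).
    by rewrite !fq // ray_actVK q1 q2 catr_cat.
  have [v1] := can_inj (@bij_funK _ f) E.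
  move/catr_inj; rewrite vN v'N => /(_ erefl)[v2 _].
  by case: v v' v1 v2 {E vN v'N q1 q2} => [? ?] [? ?] /= -> ->.
have qcover c b : exists v e,
    [/\ size v.2 = N, c = (q v).1 & b = catr (q v).2 e].
  have E := bij_invK f (c, b); case: (bij_inv f (c, b)) E => a b'.
  pose e : nat -> 'I_d := fun i => b' (N + i).
  rewrite (catr_split b' N : b' = catr (mkseq b' N) e).
  have sN : size (mkseq b' N) = N by rewrite size_mkseq.
  rewrite (fq (a, mkseq b' N)) // => -[<- <-].
  by exists (a, mkseq b' N), (ray_act (Q (a, mkseq b' N)).2 e).
pose T' : set (Tdk k d) := [set u | if u is Some (c, x) then
  exists2 v, size v.2 = N & c = (q v).1 /\ exists t, (q v).2 = x ++ t
  else True].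
have T'q v : size v.2 = N -> T' (Some (q v)).
  rewrite /T' /=; case E: (q v) => [c x] vN.
  by exists v; rewrite // E; split=> //; exists [::]; rewrite cats0.
have leafq v : size v.2 = N -> leaf T' (q v).
  move=> vN; split; first exact: T'q.
  case E : (q v) => [c x] _ [y ->] [v' v'N [cv' [t qv']]].
  have vv' : v = v'.
    by apply: (qdisj _ _ (y :: t)); rewrite // E //= qv' cat_rcons.
  move: qv'; rewrite -vv' E /= => /(congr1 size); rewrite size_cat size_rcons.
  by rewrite addSnnS -{1}[size x]addn0 => /eqP; rewrite eqn_add2l.
have T'leaf v' : leaf T' v' -> exists2 v, size v.2 = N & v' = q v.
  case: v' => c x [[v vN [cv [t qv]]] leafx]; exists v => //.
  case: t qv => [|y t] qv.
    by move: qv; rewrite cats0 cv; case: (q v) => ? ? /= ->.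
  case: (leafx (Some (c, rcons x y))); first by exists y.
  by exists v => //; split=> //; exists t; rewrite cat_rcons.
have cT' : complete_subtree T'.
  split=> //.
  - have [M HM] := node_bound N (fun v => size (q v).2).
    apply: (@sub_finite_set _ _ [set u : Tdk k d | level u <= M.+1]).
      move=> [[c x]|] //= [v vN [cv [t qv]]]; rewrite ltnS.
      by apply: leq_trans (HM v vN); rewrite qv size_cat leq_addr.
    exact: finite_level.
  - move=> [[c x]|] // v [y ->] [v' v'N [cv' [t qv']]].
    by exists v' => //; split=> //; exists (y :: t); rewrite qv' cat_rcons.
  - move=> v [c ->]; have [v' [e [v'N cv' _]]] := qcover c b0.
    by exists v' => //; split=> //; exists (q v').2.
  - move=> [[c x]|] v v'; last first.
      move=> _ _ [c' ->]; have [v2 [e [v2N cv2 _]]] := qcover c' b0.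
      by exists v2 => //; split=> //; exists (q v2).2.
    move=> [y ->] [v1 v1N [cv1 [t qv1]]] [z ->].
    have [v2 [e [v2N cv2 E]]] := qcover c (catr (rcons x z) b0).
    have [lt|le] := leqP (size (rcons x z)) (size (q v2).2).
      exists v2 => //; split=> //; exists (drop (size (rcons x z)) (q v2).2).
      rewrite -[LHS](cat_take_drop (size (rcons x z))); congr (_ ++ _).
      by rewrite -(mkseq_catr_take e lt) -E mkseq_catr_take // take_size.
    have E2 : (q v2).2 = take (size (q v2).2) x.
      rewrite -{1}[(q v2).2]take_size -(mkseq_catr_take e (leqnn _)) -E.
      by rewrite mkseq_catr_take 1?ltnW // -cats1 takel_cat // -ltnS -(size_rcons x z).
    have E12 : (q v1).2 = (q v2).2 ++ (drop (size (q v2).2) x ++ y :: t).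
      by rewrite catA {1}E2 cat_take_drop qv1 cat_rcons.
    have v12 : v2 = v1 by apply: qdisj E12 => //; rewrite -cv1 -cv2.
    move: E12; rewrite v12 => /(congr1 size)/eqP.
    by rewrite size_cat -{1}[size _]addn0 eqn_add2l size_cat /= addnS.
pose psi (u : Tdk k d) : Tdk k d :=
  if u is Some (a, x) then let v := (a, take N x) in
    node_cat (q v) ((Q v).2 (drop N x)) else None.
have psiE v w : size v.2 = N -> psi (node_cat v w) = node_cat (q v) ((Q v).2 w).
  by case: v => a x xN; rewrite /psi /node_cat /= take_size_cat ?drop_size_cat.
have leafT v : leaf [set u : Tdk k d | level u <= N.+1] v -> size v.2 = N.
  case: v => a x [/=]; rewrite ltnS leq_eqVlt => /orP[/eqP //|xN].
  move=> /(_ (Some (a, rcons x (b0 0)))); rewrite /= size_rcons ltnS => H.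
  by case: H => //; exists (b0 0).
have Tleaf v : size v.2 = N -> leaf [set u : Tdk k d | level u <= N.+1] v.
  case: v => a x /= xN; split=> [/=|u [y ->] /=]; first by rewrite xN.
  by rewrite size_rcons xN ltnn.
split=> //; exists [set u : Tdk k d | level u <= N.+1], T', psi.
split=> //; first exact: ball_complete.
  split=> [v /leafT vN|v' /T'leaf[v vN ->]].
    exists (q v); split; first exact: leafq.
    by exists (Q v).2 => [|w]; [case: (HQ v vN)|exact: psiE].
  have psi0 u : size u.2 = N -> psi (Some u) = Some (q u).
    move=> uN; have := psiE u [::] uN; rewrite /node_cat td_nil !cats0.
    by case: (u) => a x; case: (q _).
  exists v; split; first by split; [exact: Tleaf|exact: psi0].
  move=> u [/leafT uN]; rewrite psi0 // => -[quv].
  by apply: (qdisj _ _ [::]); rewrite // quv ?cats0.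
move=> v w r /leafT vN; rewrite psiE // => /on_rayP[/= r1 r2].
pose e i := r.2 (size (v.2 ++ w) + i).
have -> : r = (v.1, catr v.2 (catr w e)).
  rewrite -catr_cat -{}r1 -[in RHS]r2 -catr_split.
  by case: (r).
rewrite fq //; apply/on_rayP => /=; split=> //.
rewrite size_cat td_size mkseq_catr mkseq_ray_act mkseq_catr_take //.
by rewrite take_size.
Qed.
End WithD.
End AlmostAutGroup.

Section RayTopology.
Variables k d : nat.
Implicit Types r : ray k d.

Lemma discrete_nbhs (T : choiceType) (x : discrete_topology T) :
  nbhs x [set x].
Proof. by apply: open_nbhs_nbhs; split=> //; exact: discrete_open. Qed.

Lemma nbhs_ray_vertex r n :
  nbhs r [set r' : ray k d | ray_vertex r' n = ray_vertex r n].
Proof.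
case: n => [|n]; first by apply: filterS filterT => r'.
case: r => a b; exists ([set a], [set b' | mkseq b' n = mkseq b n]).
  split=> /=; first exact: discrete_nbhs.
  elim: n => [|n IHn]; first by apply: filterS filterT => b'.
  have Hn : nbhs (b : {ptws nat -> discrete_topology 'I_d})
      [set b' : {ptws nat -> discrete_topology 'I_d} | b' n = b n].
    by have /(_ _ (@discrete_nbhs _ (b n))) :=
      @proj_continuous _ (fun=> discrete_topology 'I_d) n b.
  by apply: filterS (filterI IHn Hn) => b' /= [E1 E2]; rewrite !mkseqS E1 E2.
by move=> [a' b'] /= [-> ->].
Qed.

Lemma ray_continuous (F : ray k d -> ray k d) :
  (forall r r' n, ray_vertex r' n = ray_vertex r n ->
     ray_vertex (F r') n = ray_vertex (F r) n) -> continuous F.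
Proof.
move=> HF r.
have F2 :
    (fun r' => (F r').2) @ r --> ((F r).2 : {ptws nat -> discrete_topology 'I_d}).
  apply/cvg_sup => n A [B [[C Co <-] Br] BA].
  apply: filterS (nbhs_ray_vertex r n.+2) => r' /(HF _ _ n.+2) Er'.
  have E1 : mkseq (F r').2 n.+1 = mkseq (F r).2 n.+1.
    exact: (congr1 (fun u => if u is Some p then p.2 else [::]) Er').
  apply: (BA (F r').2); move: Br; rewrite /preimage /=.
  by move: E1; rewrite !mkseqS => /rcons_inj[_ ->].
move=> A [[B C] /= [/principal_filterP Br HC] BCA].
apply: filterS (filterI (nbhs_ray_vertex r 1) (F2 _ HC)) => r' [].
move=> /(HF _ _ 1) [E1] Cr'; apply: (BCA (F r')); split=> //=.
by rewrite E1.
Qed.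
End RayTopology.

Section Piecewise.
Variables (k d : nat) (D : {group 'S_d}).
Notation W := (sg_set (WD D)).
Implicit Types (f g : self_bij (ray k d)) (w : seq 'I_d).

Lemma piecewise_up f : piecewise W f ->
  exists N, forall a w, N <= size w ->
    exists a' w', exists2 g : tree_aut (Td d), W g &
      forall b, f (a, catr w b) = (a', catr w' (ray_act g b)).
Proof.
move=> [N fN]; exists N => a w Nw.
have [a' [w' [g Wg fg]]] := fN a (take N w) (size_takel Nw).
have [h Wh gh] := WD_section (drop N w) Wg.
exists a', (w' ++ (g (drop N w) : seq 'I_d)), h => // b.
by rewrite -{1}(cat_take_drop N w) catr_cat fg (ray_act_catr _ gh) catr_cat.
Qed.

Lemma piecewiseM f g : piecewise W f -> piecewise W g -> piecewise W (f * g)%g.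
Proof.
move=> /piecewise_up[M fM] [N gN]; exists (N + M) => a w wNM.
have wN : size (take N w) = N by rewrite size_takel // wNM leq_addr.
have wM : size (drop N w) = M by rewrite size_drop wNM addKn.
have [a1 [w1 [g1 Wg1 gg1]]] := gN a _ wN.
have [h Wh g1h] := WD_section (drop N w) Wg1.
have [|a2 [w2 [f1 Wf1 ff1]]] := fM a1 (w1 ++ (g1 (drop N w) : seq 'I_d)).
  by rewrite size_cat td_size wM leq_addl.
exists a2, w2, (f1 * h)%g => [|b]; first exact: (sg_mul Wf1 Wh).
rewrite -{1}(cat_take_drop N w) catr_cat /= gg1 (ray_act_catr _ g1h).
by rewrite -catr_cat ff1 ray_actM.
Qed.

Lemma piecewiseV f : piecewise W f -> piecewise W f^-1%g.
Proof.
move=> [N fN].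
have {fN} [Q HQ] := piece_choice fN.
have [M HM] := node_bound N (fun v => size (Q v).1.2).
exists M => c u uM.
have [[b0]|nb] := pselect (inhabited (nat -> 'I_d)); last first.
  exists c, u, 1%g => [|b]; first exact: sg_one (WD D).
  by case: nb.
case E : (bij_inv f (c, catr u b0)) => [a b].
pose v : node k d := (a, mkseq b N).
have vN : size v.2 = N by rewrite size_mkseq.
have [Wv fv] := HQ v vN.
pose e i := b (N + i).
have := bij_invK f (c, catr u b0); rewrite E (catr_split b N : b = catr v.2 e).
rewrite (fv e) => -[cE uE].
have uE' : u = (Q v).1.2 ++ drop (size (Q v).1.2) u.
  rewrite -{1}(cat_take_drop (size (Q v).1.2) u); congr (_ ++ _).
  have le : size (Q v).1.2 <= size u by rewrite uM; apply: HM.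
  by rewrite -(mkseq_catr_take b0 le) -uE mkseq_catr_take // take_size.
set t := drop _ u in uE'.
have [h Wh gh] := WD_section t (sg_inv Wv).
exists a, (v.2 ++ (aut_fun (Q v).2^-1%g t : seq 'I_d)), h => // b'.
rewrite uE' catr_cat -cE catr_cat -(ray_act_catr _ gh).
by apply: (can_inj (@bij_funK _ f)); rewrite /= bij_invK fv ray_actVK.
Qed.

Lemma homeo1 : homeo (1%g : self_bij (ray k d)).
Proof. by split=> r; apply: cvg_id. Qed.
Lemma homeoM f g : homeo f -> homeo g -> homeo (f * g)%g.
Proof.
move=> [f1 f2] [g1 g2]; split=> r.
  by apply: (@continuous_comp _ _ _ g f); [exact: g1|exact: f1].
apply: (@continuous_comp _ _ _ (bij_inv f) (bij_inv g)); first exact: f2.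
exact: g2.
Qed.
Lemma homeoV f : homeo f -> homeo f^-1%g.
Proof. by case. Qed.

Lemma almost_autM f g :
  almost_aut W f -> almost_aut W g -> almost_aut W (f * g)%g.
Proof.
move=> Hf Hg; apply: piecewise_almost_aut.
  by apply: homeoM; [case: Hf|case: Hg].
by apply: piecewiseM; apply: almost_aut_piecewise.
Qed.

Lemma almost_autV f : almost_aut W f -> almost_aut W f^-1%g.
Proof.
move=> Hf; apply: piecewise_almost_aut; first by apply: homeoV; case: Hf.
by apply: piecewiseV; apply: almost_aut_piecewise.
Qed.

Definition AAutD_sg : subgroup (self_bij (ray k d)) :=
  Subgroup (almost_aut1 k (sg_one (WD D))) almost_autM almost_autV.

Definition AAutD := sg_type AAutD_sg.
HB.instance Definition _ := monoid.Group.on AAutD.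

End Piecewise.

Section BoundaryAction.
Variables k d : nat.
Implicit Types (g h : tree_aut (Tdk k d)) (r : ray k d).

(* The action of an automorphism of T_(d,k) on the boundary; the fallback
   values are never used, see boundary_actP. *)
Definition boundary_act g r : ray k d :=
  (if g (Some (r.1, [::])) is Some (a, _) then a else r.1,
   fun n => if g (Some (r.1, mkseq r.2 n.+1)) is Some (_, w)
            then last (r.2 n) w else r.2 n).

Lemma boundary_actP g r n :
  ray_vertex (boundary_act g r) n = g (ray_vertex r n).
Proof.
case: n => [|n]; first by rewrite (aut_root g).
case: r => a b; elim: n => [|n IHn].
  have : child (g troot) (g (Some (a, [::]))).
    by apply: aut_child; exists a.
  by rewrite aut_root => -[a' ga]; rewrite /= /mkseq /= ga.
have : child (g (Some (a, mkseq b n))) (g (Some (a, mkseq b n.+1))).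
  by apply: aut_child; exists (b n); rewrite mkseqS.
rewrite -[Some (a, mkseq b n)]/(ray_vertex (a, b) n.+1) -IHn => -[y gy].
rewrite -[ray_vertex (a, b) n.+2]/(Some (a, mkseq b n.+1)) gy /=.
rewrite mkseqS; congr (Some (_, rcons _ _)).
by rewrite /boundary_act /= gy /= last_rcons.
Qed.

Lemma ray_vertex_inj r r' :
  (forall n, ray_vertex r n = ray_vertex r' n) -> r = r'.
Proof.
case: r r' => a b [a' b'] E; have [aa'] := E 1.
congr pair => //; apply: mkseq_inj => n.
exact: (congr1 (fun u => if u is Some p then p.2 else [::]) (E n.+1)).
Qed.

Lemma boundary_act1 r : boundary_act 1%g r = r.
Proof. by apply: ray_vertex_inj => n; rewrite boundary_actP. Qed.
Lemma boundary_actM g h r :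
  boundary_act (g * h)%g r = boundary_act g (boundary_act h r).
Proof. by apply: ray_vertex_inj => n; rewrite !boundary_actP autME. Qed.
Lemma boundary_actK g : cancel (boundary_act g) (boundary_act g^-1%g).
Proof. by move=> r; rewrite -boundary_actM mulVg boundary_act1. Qed.
Lemma boundary_actVK g : cancel (boundary_act g^-1%g) (boundary_act g).
Proof. by move=> r; rewrite -boundary_actM mulgV boundary_act1. Qed.

Definition boundary_bij g : self_bij (ray k d) :=
  SelfBij (boundary_actK g) (boundary_actVK g).

Lemma boundary_bijM g h :
  boundary_bij (g * h)%g = (boundary_bij g * boundary_bij h)%g.
Proof. by apply: bijP => r; exact: boundary_actM. Qed.

Lemma boundary_act_continuous g : continuous (boundary_act g).
Proof. by apply: ray_continuous => r r' n E; rewrite !boundary_actP E. Qed.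

Lemma boundary_bij_homeo g : homeo (boundary_bij g).
Proof. by split; exact: boundary_act_continuous. Qed.
End BoundaryAction.

Section Wk.
Variables (k d : nat) (D : {group 'S_d}).
Notation W := (sg_set (WD D)).

(* Taking w = [::] shows that the elements of W_k(D) fix level one. *)
Definition Wk_set : set (tree_aut (Tdk k d)) :=
  [set f | forall a, exists2 g : tree_aut (Td d), W g &
     forall w, f (Some (a, w)) = Some (a, g w)].

Lemma Wk_set1 : Wk_set 1%g.
Proof. by move=> a; exists 1%g => //; exact: sg_one (WD D). Qed.
Lemma Wk_setM x y : Wk_set x -> Wk_set y -> Wk_set (x * y)%g.
Proof.
move=> Wx Wy a; have [g Wg xg] := Wx a; have [h Wh yh] := Wy a.
exists (g * h)%g; first exact: (sg_mul Wg Wh).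
by move=> w; rewrite !autME yh xg.
Qed.
Lemma Wk_setV x : Wk_set x -> Wk_set x^-1%g.
Proof.
move=> Wx a; have [g Wg xg] := Wx a; exists g^-1%g; first exact: (sg_inv Wg).
by move=> w; apply: (@aut_inj _ x); rewrite autVK xg autVK.
Qed.
Definition Wk_sg : subgroup (tree_aut (Tdk k d)) :=
  Subgroup Wk_set1 Wk_setM Wk_setV.

Definition Wk := sg_type Wk_sg.
HB.instance Definition _ := monoid.Group.on Wk.

Definition Wk_stab (n : nat) : set Wk :=
  [set f | level_stab n (val f)].

Lemma Wk_stab1 n : Wk_stab n 1%g. Proof. by []. Qed.
Lemma Wk_stabM n x y : Wk_stab n x -> Wk_stab n y -> Wk_stab n (x * y)%g.
Proof. exact: level_stabM. Qed.
Lemma Wk_stabV n x : Wk_stab n x -> Wk_stab n x^-1%g.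
Proof. exact: level_stabV. Qed.
Lemma Wk_stab_anti m n : n <= m -> Wk_stab m `<=` Wk_stab n.
Proof. by move=> nm x; exact: level_stab_anti. Qed.

(* The profinite topology of W_k(D): the pointwise level stabilizers form a
   neighbourhood basis of 1. *)
HB.instance Definition _ := hasNbhs.Build Wk (coset_nbhs Wk_stab).
HB.instance Definition _ := Nbhs_isNbhsTopological.Build Wk
  (coset_nbhs_filter Wk_stab1 Wk_stab_anti)
  (coset_nbhs_singleton Wk_stab1) (coset_nbhs_nbhs Wk_stabM).

Lemma Wk_act (f : tree_aut (Tdk k d)) a (g : tree_aut (Td d)) b :
  (forall w, f (Some (a, w)) = Some (a, g w)) ->
  boundary_act f (a, b) = (a, ray_act g b).
Proof.
move=> fg; apply: ray_vertex_inj => n; rewrite boundary_actP.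
case: n => [|n]; first exact: aut_root f.
by rewrite [LHS]fg /= mkseq_ray_act.
Qed.

Lemma Wk_almost_aut (f : Wk) : almost_aut W (boundary_bij (val f)).
Proof.
apply: piecewise_almost_aut; first exact: boundary_bij_homeo.
exists 0 => a [] // _; have [g Wg fg] := sg_valP f a.
by exists a, [::], g => // b; rewrite !catr0; apply: Wk_act.
Qed.

Definition Wk_incl (f : Wk) : AAutD k D :=
  sg_elt (H := AAutD_sg k D) (Wk_almost_aut f).

Lemma Wk_inclM : {morph Wk_incl : x y / (x * y)%g}.
Proof. by move=> x y; apply: val_inj; exact: boundary_bijM. Qed.
Lemma Wk_incl1 : Wk_incl 1%g = 1%g.
Proof. by apply: (mulgI (Wk_incl 1%g)); rewrite -Wk_inclM !mulg1. Qed.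
Lemma Wk_inclV x : Wk_incl x^-1%g = (Wk_incl x)^-1%g.
Proof. by apply: (mulgI (Wk_incl x)); rewrite -Wk_inclM !mulgV Wk_incl1. Qed.

Lemma Wk_glue (f : self_bij (ray k d)) N :
  (forall a w, size w = N -> exists2 s : tree_aut (Td d), W s &
     forall b, f (a, catr w b) = (a, catr w (ray_act s b))) ->
  exists2 x : Wk, Wk_stab N.+1 x & boundary_bij (val x) = f.
Proof.
move=> fN.
have {fN} [s Hs] : {s : node k d -> tree_aut (Td d) & forall v, W (s v) /\
    (size v.2 = N -> forall b,
      f (v.1, catr v.2 b) = (v.1, catr v.2 (ray_act (s v) b)))}.
  apply: (@choice _ _ (fun (v : node k d) (p : tree_aut (Td d)) => W p /\
    (size v.2 = N -> forall b,
      f (v.1, catr v.2 b) = (v.1, catr v.2 (ray_act p b))))) => v.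
  have [vN|vN] := pselect (size v.2 = N).
    by have [p Wp fp] := fN v.1 v.2 vN; exists p.
  by exists 1%g; split=> [|/vN]; [exact: sg_one (WD D)|].
have {Hs} [Ws fs] := all_and2 Hs.
have [h Hh] : {h : 'I_k -> tree_aut (Td d) & forall a, W (h a) /\
    forall w, h a w = take N w ++ (s (a, take N w) (drop N w) : seq 'I_d)}.
  apply: (@choice _ _ (fun a (p : tree_aut (Td d)) => W p /\
    forall w, p w = take N w ++ (s (a, take N w) (drop N w) : seq 'I_d))) => a.
  by have [p Wp ps] := WD_glue N (fun u => Ws (a, u)); exists p.
have {Hh} [Wh hE] := all_and2 Hh.
pose F (t : 'I_k -> tree_aut (Td d)) (u : Tdk k d) : Tdk k d :=
  if u is Some (a, w) then Some (a, t a w) else None.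
have FK : cancel (F h) (F (fun a => (h a)^-1%g)).
  by move=> [[a w]|] //=; rewrite autK.
have FVK : cancel (F (fun a => (h a)^-1%g)) (F h).
  by move=> [[a w]|] //=; rewrite autVK.
have Fc t u v : tdk_child u v -> tdk_child (F t u) (F t v).
  case: u => [[a w]|] [x ->] /=; last by exists x; rewrite td_nil.
  by have [y ->] := td_rcons (t a) w x; exists y.
pose x := @mk_aut (Tdk k d) _ _ FK FVK erefl (Fc h) (Fc (fun a => (h a)^-1%g)).
have Wx : Wk_set x by move=> a; exists (h a).
exists (sg_elt (H := Wk_sg) Wx).
  move=> [[a w]|] //= wN; rewrite /aut_fun /= hE.
  by rewrite drop_oversize ?take_oversize ?td_nil ?cats0.
apply: bijP => -[a b]; rewrite [LHS](@Wk_act x a (h a)) //.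
have bN : size (mkseq b N) = N by rewrite size_mkseq.
rewrite (catr_split b N); set e : nat -> 'I_d := fun i => b (N + i).
rewrite (fs (a, mkseq b N)) // (@ray_act_catr _ (h a) (s (a, mkseq b N))).
  rewrite hE drop_oversize ?bN // td_nil cats0 take_oversize ?bN //.
move=> u; rewrite !hE take_size_cat ?drop_size_cat ?bN //.
by rewrite drop_oversize ?take_oversize ?bN // td_nil cats0.
Qed.

(* W_k(D) is commensurated in AAut_D(T_(d,k)). *)
Lemma Wk_conj (g : AAutD k D) n : exists m, forall x : Wk, Wk_stab m x ->
  exists2 y : Wk, Wk_stab n y & (g^-1 * (Wk_incl x * g))%g = Wk_incl y.
Proof.
have [N0 gN0] := piecewise_up (almost_aut_piecewise (sg_valP g)).
pose N := maxn N0 n.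
have [Q HQ] := piece_choice (fun a w (wN : size w = N) =>
  gN0 a w (leq_trans (leq_maxl N0 n) (eq_leq (esym wN)))).
have [M HM] := node_bound N (fun v => size (Q v).1.2).
exists M.+1 => x xM.
have [|y yN yE] := @Wk_glue (bij_mul (bij_opp (val g))
   (bij_mul (boundary_bij (val x)) (val g))) N.
  move=> a w wN; have [Wq gq] := HQ (a, w) wN.
  have qM := HM (a, w) wN; set q := Q (a, w) in Wq gq qM.
  have [p Wp xp] := sg_valP x q.1.1.
  have pq : p q.1.2 = q.1.2.
    have := xM (Some (q.1.1, q.1.2)) qM.
    by rewrite xp => -[].
  have [h Wh ph] := WD_section q.1.2 Wp.
  exists (q.2^-1 * (h * q.2))%g.
    by apply: sg_mul; [exact: sg_inv|exact: sg_mul].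
  move=> b; rewrite /= gq (Wk_act _ xp) (ray_act_catr _ ph) pq.
  apply: (can_inj (@bij_funK _ (val g))).
  by rewrite bij_invK gq !ray_actM ray_actVK.
exists y; first by apply: Wk_stab_anti yN; rewrite leqW // leq_maxr.
by apply: val_inj; rewrite /= yE.
Qed.

Definition AAutD_nbhs_base (n : nat) : set (AAutD k D) := Wk_incl @` Wk_stab n.

Lemma AAutD_base1 n : AAutD_nbhs_base n 1%g.
Proof. by exists 1%g => //; exact: Wk_incl1. Qed.
Lemma AAutD_baseM n x y : AAutD_nbhs_base n x -> AAutD_nbhs_base n y ->
  AAutD_nbhs_base n (x * y)%g.
Proof.
move=> [x' nx <-] [y' ny <-].
by exists (x' * y')%g; [exact: Wk_stabM|exact: Wk_inclM].
Qed.
Lemma AAutD_base_anti m n :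
  n <= m -> AAutD_nbhs_base m `<=` AAutD_nbhs_base n.
Proof. by move=> nm _ [x mx <-]; exists x => //; exact: Wk_stab_anti mx. Qed.

(* The topology of AAut_D(T_(d,k)): the translates g V of the neighbourhoods V
   of 1 in W_k(D) form a neighbourhood basis of g. By Wk_incl_continuous,
   Wk_incl_open and AAutD_topology_unique below, this is the unique group
   topology for which the inclusion of W_k(D) is continuous and open. *)
HB.instance Definition _ :=
  hasNbhs.Build (AAutD k D) (coset_nbhs AAutD_nbhs_base).
HB.instance Definition _ := Nbhs_isNbhsTopological.Build (AAutD k D)
  (coset_nbhs_filter AAutD_base1 AAutD_base_anti)
  (coset_nbhs_singleton AAutD_base1) (coset_nbhs_nbhs AAutD_baseM).

Lemma AAutD_mul_continuous :
  continuous (fun p : AAutD k D * AAutD k D => (p.1 * p.2)%g).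
Proof.
move=> [g h] A /= [n An]; have [m Hm] := Wk_conj h n.
exists ([set g' | AAutD_nbhs_base m (g^-1 * g')%g],
        [set h' | AAutD_nbhs_base n (h^-1 * h')%g]).
  by split=> /=; [exists m|exists n] => u uU; rewrite /= mulKg.
move=> [g' h'] /= [[x mx xE] [y ny yE]].
have [z nz zE] := Hm x mx.
rewrite /preimage /= (_ : g' * h' = g * h * (Wk_incl z * Wk_incl y))%g; last first.
  by rewrite -zE xE yE -!mulgA !mulKVg.
apply: An; apply: AAutD_baseM; [by exists z|by exists y].
Qed.

Lemma AAutD_inv_continuous : continuous (fun x : AAutD k D => x^-1%g).
Proof.
move=> g A /= [n An]; have [m Hm] := Wk_conj g^-1%g n.
exists m => _ [x mx <-]; have [y ny yE] := Hm _ (Wk_stabV mx).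
rewrite /preimage /= (_ : _^-1 = g^-1 * Wk_incl y)%g; first by apply: An; exists y.
by rewrite -yE invgK invgM Wk_inclV mulKg.
Qed.

HB.instance Definition _ := isTopologicalGroup.Build (AAutD k D)
  AAutD_mul_continuous AAutD_inv_continuous.

Lemma Wk_incl_continuous : continuous Wk_incl.
Proof.
move=> x A [n An]; exists n => u nu; rewrite /preimage /= Wk_inclM.
by apply: An; exists u.
Qed.

Lemma Wk_incl_open (A : set Wk) : open A -> open (Wk_incl @` A).
Proof.
rewrite !openE => oA _ [x Ax <-]; have [n An] := oA x Ax.
by exists n => _ [u nu <-]; exists (x * u)%g; [exact: An|exact: Wk_inclM].
Qed.

Lemma Wk_incl_inj : 0 < d -> injective Wk_incl.
Proof.
move=> d0 x y /(congr1 val) /= xy; apply/val_inj/autP => -[[a w]|]; last first.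
  by rewrite !(aut_root (val x)) (aut_root (val y)).
have -> : Some (a, w) =
    ray_vertex (a, catr w (fun=> Ordinal d0)) (size w).+1 :> Tdk k d.
  by rewrite /= mkseq_catr_take // take_size.
rewrite -!boundary_actP; congr ray_vertex.
exact: (congr1 (fun f : self_bij (ray k d) => f _) xy).
Qed.

Lemma AAutD_topology_unique (G : topGroupType) (phi : AAutD k D -> G) :
  bijective phi -> {morph phi : x y / (x * y)%g} ->
  continuous (phi \o Wk_incl) ->
  (forall A, open A -> open ((phi \o Wk_incl) @` A)) ->
  forall A, open A <-> open (phi @` A).
Proof.
move=> /bij_inj phiI phiM phic phio A; split; rewrite openE => oA.
  rewrite openE => _ [g Ag <-]; have [n An] := oA g Ag.
  have oU : open (Wk_stab n).
    by rewrite openE => x nx; exists n => u nu; apply: Wk_stabM.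
  have := phio _ oU; rewrite openE => /(_ (phi 1%g)) nU.
  have {}nU : nbhs ((phi g)^-1 * phi g)%g ((phi \o Wk_incl) @` Wk_stab n).
    rewrite mulVg.
    have <- : phi 1%g = 1%g.
      by apply: (mulgI (phi 1%g)); rewrite -phiM !mulg1.
    by apply: nU; exists 1%g => //=; rewrite Wk_incl1.
  have := @mulg_continuous_l G (phi g)^-1%g (phi g) _ nU.
  apply: (@filterS _ (nbhs (phi g))) => y [x nx xy].
  exists (g * Wk_incl x)%g; first by apply: An; exists x.
  by rewrite phiM -[phi (Wk_incl x)]/((phi \o Wk_incl) x) xy mulKVg.
move=> g Ag.
have nA : nbhs (phi g * (phi \o Wk_incl) 1%g)%g (phi @` A).
  by rewrite /= Wk_incl1 -phiM mulg1; apply: oA; exists g.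
have [n An] := phic 1%g _ (@mulg_continuous_l G (phi g) _ _ nA).
exists n => _ [x nx <-]; have := An x nx; rewrite /preimage /= mul1g -phiM.
by move=> [y Ay /phiI <-].
Qed.

End Wk.

(* Main.v *)
(* A "partition" is a finite decomposition of the boundary into balls, each ball
   being identified with the boundary of T_d up to W(D). Partitions are ordered
   by refinement; the order is directed, and G = AAut_D acts on it, transitively
   on the partitions with a given number of balls, with compact open stabilizers.
   Partitions with at most n balls form a poset Pi_n. For n large, the coarsenings
   of a partition with more than n balls form, by merging d balls into one, a
   flag complex in which any four vertices have a common neighbour; hence any
   cocycle on Pi_n with values in an arbitrary group extends to Pi_(n+1) (the
   discrete Morse theory argument of Brown and Stein, in the language of cocycles
   instead of paths). So every cocycle on Pi_n extends to Pi_m for all m, and it is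
   a coboundary on every finite set of partitions by directedness. Let P0 be a
   partition with n balls. The cocycle property for G-translates of P0 means that
   the set S of all g such that P0 and g P0 have a common coarsening generates G
   with relators of length at most 3, and S is compact since it is a finite union
   of cosets of the stabilizer of P0. *)

Require Import Defs.
From HB Require Import structures.
From mathcomp Require Import all_boot all_fingroup.
From mathcomp Require Import boolp classical_sets functions cardinality topology.

Set Implicit Arguments.
Unset Strict Implicit.
Unset Printing Implicit Defensive.

Local Open Scope classical_set_scope.

(** * The group presented by generators and relators *)

Section PresentedGroup.
Variables (T : choiceType) (R : set (gword T)).

Definition gword_inv (w : gword T) : gword T :=
  rev [seq (p.1, ~~ p.2) | p <- w].

Lemma gword_invM w : presented_eq R (w ++ gword_inv w) [::].
Proof.
elim: w => [|[x b] w IHw]; first exact: Peq_refl.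
have -> : gword_inv ((x, b) :: w) = gword_inv w ++ [:: (x, ~~ b)].
  by rewrite /gword_inv /= rev_cons -cats1.
apply: Peq_trans (Peq_cancel R x b).
rewrite -(cat1s _ w) -(cat1s _ [:: _]) -catA [w ++ _]catA.
apply: Peq_cat (Peq_refl _ _) _; rewrite -[X in presented_eq R _ X]cat0s.
exact: Peq_cat IHw (Peq_refl _ _).
Qed.

Lemma gword_invK : involutive gword_inv.
Proof.
move=> w; rewrite /gword_inv map_rev revK -map_comp -[RHS]map_id.
by apply: eq_map => -[x b] /=; rewrite negbK.
Qed.

Lemma gword_invV w : presented_eq R (gword_inv w ++ w) [::].
Proof. by rewrite -{2}(gword_invK w); apply: gword_invM. Qed.

Lemma gword_inv_eq w1 w2 : presented_eq R w1 w2 ->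
  presented_eq R (gword_inv w1) (gword_inv w2).
Proof.
move=> w12.
apply: (Peq_trans (w2 := gword_inv w1 ++ (w2 ++ gword_inv w2))).
  rewrite -{1}[gword_inv w1]cats0.
  by apply: Peq_cat (Peq_refl _ _) (Peq_sym (gword_invM _)).
rewrite catA -[X in presented_eq R _ X]cat0s; apply: Peq_cat (Peq_refl _ _).
apply: Peq_trans (gword_invV w1).
exact: Peq_cat (Peq_refl _ _) (Peq_sym w12).
Qed.

Definition presented_rel : rel (gword T) :=
  fun w1 w2 => `[< presented_eq R w1 w2 >].

Lemma presented_rel_refl : reflexive presented_rel.
Proof. by move=> w; apply/asboolP/Peq_refl. Qed.
Lemma presented_rel_sym : symmetric presented_rel.
Proof.
by move=> w1 w2; apply/asboolP/asboolP; apply: Peq_sym.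
Qed.
Lemma presented_rel_trans : transitive presented_rel.
Proof.
move=> w2 w1 w3 /asboolP w12 /asboolP w23; apply/asboolP.
exact: Peq_trans w12 w23.
Qed.

Canonical presented_equiv := EquivRel presented_rel
  presented_rel_refl presented_rel_sym presented_rel_trans.

(** The group with generators [T] and relators [R] as an actual [groupType], so that the universal
    property in [is_presentationP] can be tested on it. *)
Definition presented_group := {eq_quot presented_equiv}%qT.
HB.instance Definition _ := Choice.on presented_group.

Definition gword_class (w : gword T) : presented_group := (\pi_presented_group w)%qT.

Lemma gword_classP w1 w2 :
  gword_class w1 = gword_class w2 <-> presented_eq R w1 w2.
Proof. by split=> [/eqquotP/asboolP|H]; last apply/eqquotP/asboolP. Qed.

Local Notation repr := generic_quotient.repr.

Lemma gword_class_surj (x : presented_group) : exists w, x = gword_class w.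
Proof. by exists (repr x); rewrite /gword_class reprK. Qed.

Let pmul (x y : presented_group) := gword_class (repr x ++ repr y).
Let pinv (x : presented_group) := gword_class (gword_inv (repr x)).

Let repr_class w : presented_eq R (repr (gword_class w)) w.
Proof. by apply/gword_classP; rewrite /gword_class reprK. Qed.

Let pmulE w1 w2 : pmul (gword_class w1) (gword_class w2) = gword_class (w1 ++ w2).
Proof. by apply/gword_classP/Peq_cat; apply: repr_class. Qed.
Let pinvE w : pinv (gword_class w) = gword_class (gword_inv w).
Proof. by apply/gword_classP/gword_inv_eq/repr_class. Qed.

Let pmulA : associative pmul.
Proof.
move=> x y z; have [a ->] := gword_class_surj x; have [b ->] := gword_class_surj y.
by have [c ->] := gword_class_surj z; rewrite !pmulE catA.
Qed.
Let pmul1 : left_id (gword_class [::]) pmul.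
Proof. by move=> x; have [a ->] := gword_class_surj x; rewrite pmulE. Qed.
Let pmulr1 : right_id (gword_class [::]) pmul.
Proof. by move=> x; have [a ->] := gword_class_surj x; rewrite pmulE cats0. Qed.
Let pmulV : left_inverse (gword_class [::]) pinv pmul.
Proof.
move=> x; have [a ->] := gword_class_surj x; rewrite pinvE pmulE.
exact/gword_classP/gword_invV.
Qed.
Let pmulrV : right_inverse (gword_class [::]) pinv pmul.
Proof.
move=> x; have [a ->] := gword_class_surj x; rewrite pinvE pmulE.
exact/gword_classP/gword_invM.
Qed.
HB.instance Definition _ :=
  isGroup.Build presented_group pmulA pmul1 pmulr1 pmulV pmulrV.

Lemma gword_class_cat w1 w2 :
  gword_class (w1 ++ w2) = (gword_class w1 * gword_class w2)%g.
Proof. by rewrite -pmulE. Qed.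

Lemma gword_class_eval w :
  gword_eval (fun x => gword_class [:: (x, true)]) w = gword_class w.
Proof.
elim: w => [|[x b] w IHw] //=; rewrite IHw -[(x, b) :: w]cat1s gword_class_cat; congr mulg.
by case: b => //; rewrite -[RHS]pinvE.
Qed.

End PresentedGroup.

Lemma gword_eval_cat (G : groupType) T (v : T -> G) w1 w2 :
  gword_eval v (w1 ++ w2) = (gword_eval v w1 * gword_eval v w2)%g.
Proof. by elim: w1 => [|[x b] w IHw] /=; rewrite ?mul1g // IHw mulgA. Qed.

Lemma presented_eq_eval (G : groupType) T (v : T -> G) (R : set (gword T)) w1 w2 :
  (forall r, R r -> gword_eval v r = 1%g) ->
  presented_eq R w1 w2 -> gword_eval v w1 = gword_eval v w2.
Proof.
move=> R1; elim=> //; first by move=> ? ? ? _ -> _ ->.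
  by move=> ? ? ? ? _ E1 _ E2; rewrite !gword_eval_cat E1 E2.
by move=> x [] /=; rewrite mulg1 ?mulgV ?mulVg.
Qed.

(** Take for [H] the presented group itself, where a word evaluates to its own class: a word trivial
    in [G] is then a consequence of [R]. *)
Lemma is_presentationP (G : groupType) (T : choiceType) (v : T -> G) (R : set (gword T)) :
  (forall g, exists w, gword_eval v w = g) ->
  (forall r, R r -> gword_eval v r = 1%g) ->
  (forall (H : groupType) (u : T -> H), (forall r, R r -> gword_eval u r = 1%g) ->
     forall w, gword_eval v w = 1%g -> gword_eval u w = 1%g) ->
  is_presentation v R.
Proof.
move=> gen R1 univ; split=> // w1 w2; split; last exact: presented_eq_eval.
move=> E; have E1 : gword_eval v (w1 ++ gword_inv w2) = 1%g.
  rewrite gword_eval_cat E -gword_eval_cat.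
  by rewrite (presented_eq_eval (R := R) (w2 := [::])) //; apply: gword_invM.
have H : gword_class R (w1 ++ gword_inv w2) = gword_class R [::].
  rewrite -!gword_class_eval; apply: univ E1 => r Rr.
  by rewrite gword_class_eval; apply/gword_classP/Peq_relator.
move: H; rewrite gword_class_cat => H; apply/gword_classP.
apply: (mulIg (gword_class R (gword_inv w2))); rewrite H -gword_class_cat.
exact/esym/gword_classP/gword_invM.
Qed.
(** * Extension of cocycles *)

Section Cocycles.
Variables (T : Type) (le : T -> T -> Prop) (rk : T -> nat).
Hypothesis le_refl : forall P, le P P.
Hypothesis le_trans : forall P Q R, le P Q -> le Q R -> le P R.
Hypothesis le_anti : forall P Q, le P Q -> le Q P -> P = Q.
Hypothesis rk_le : forall P Q, le P Q -> rk P <= rk Q.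
Hypothesis rk_eq : forall P Q, le P Q -> rk P = rk Q -> P = Q.

(* M indexes the merges of P, that is, its maximal coarsenings m a; dj a b says
   that a and b merge disjoint sets of balls, so that they can be done together. *)
Definition flexible (P : T) := exists (M : Type) (m : M -> T) (dj : M -> M -> Prop),
  [/\ inhabited M,
      forall a, le (m a) P /\ rk (m a) < rk P,
      forall a b, dj a b -> dj b a,
      forall Q, le Q P -> Q <> P -> exists a, le Q (m a) &
  [/\ forall a b c e, exists x, [/\ dj x a, dj x b, dj x c & dj x e],
      forall a b Q, le Q (m a) -> le Q (m b) -> m a = m b \/ dj a b,
      forall a b, dj a b -> exists R, [/\ le R (m a), le R (m b) &
        forall Q, le Q (m a) -> le Q (m b) -> le Q R] &
      forall a b c, dj a b -> dj a c -> dj b c ->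
        exists R, [/\ le R (m a), le R (m b) & le R (m c)]]].

(** By induction on the rank of [P]: choose merges [m a] above [Q] and [m b] above [Q']. These may
    have no common coarsening, but some [x] is disjoint from both, and coarsenings common to [m x]
    and [m a], then to [m x] and [m b], link [Q] to [Q']. *)
Lemma connected_below (N : nat) (E : T -> T -> Prop) :
  (forall P, N < rk P -> flexible P) ->
  (forall P Q, E P Q -> E Q P) -> (forall P Q R, E P Q -> E Q R -> E P R) ->
  (forall P Q, le P Q -> rk Q <= N -> E P Q) ->
  forall P Q Q', le Q P -> le Q' P -> rk Q <= N -> rk Q' <= N -> E Q Q'.
Proof.
move=> flex Esym Etrans Ele.
have lower P : exists2 Q, le Q P & rk Q <= N.
  have [n] := ubnP (rk P); elim: n P => // n IHn P Pn.
  have [PN|NP] := leqP (rk P) N; first by exists P.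
  have [M [m [dj [[a] mP _ _ _]]]] := flex P NP; have [maP rma] := mP a.
  have [|Q Qm QN] := IHn (m a); first exact: leq_trans rma _.
  by exists Q => //; apply: le_trans maP.
move=> P; have [n] := ubnP (rk P); elim: n P => // n IHn P Pn Q Q' QP Q'P QN Q'N.
have [PN|NP] := leqP (rk P) N.
  by apply: (Etrans _ P); [exact: Ele|apply/Esym/Ele].
have [M [m [dj [_ mP _ mex [mdj _ mmeet _]]]]] := flex P NP.
have neP X : rk X <= N -> X <> P by move=> XN XP; move: NP; rewrite -XP ltnNge XN.
have [a Qa] := mex Q QP (neP Q QN); have [b Q'b] := mex Q' Q'P (neP Q' Q'N).
have [x [xa xb _ _]] := mdj a b a a.
have [R [Rx Ra _]] := mmeet _ _ xa; have [R' [R'x R'b _]] := mmeet _ _ xb.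
have [L LR LN] := lower R; have [L' L'R' L'N] := lower R'.
have IHm c := IHn (m c) (leq_trans (proj2 (mP c)) Pn).
apply: (Etrans _ L); first by apply: (IHm a) => //; apply: le_trans Ra.
apply: (Etrans _ L'); last by apply: (IHm b) => //; apply: le_trans R'b.
by apply: (IHm x) => //; [apply: le_trans Rx|apply: le_trans R'x].
Qed.

Variable H : groupType.
Implicit Types (c : T -> T -> H) (P Q R : T).

(** Values at pairs whose finer member has rank above [n] are unconstrained, hence free to be
    redefined when [n] grows. *)
Definition cocycle (n : nat) c :=
  forall P Q R, le P Q -> le Q R -> rk R <= n -> c P R = (c P Q * c Q R)%g.

(** The potential [cP] will provide the values of the extended cocycle at pairs ending in [P]. Every
    strict coarsening lies below some merge, so it suffices to pick one element [F a] for each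
    merge, compatibly with [c]. *)
Lemma cocycle_top n c P : cocycle n c -> flexible P -> rk P = n.+1 ->
  exists cP : T -> H, forall Q Q', le Q Q' -> le Q' P -> Q' <> P ->
    cP Q = (c Q Q' * cP Q')%g.
Proof.
move=> cc [M [m [dj [[a0] mP djC mex [mdj mcase mmeet mtri]]]]] Pn.
have {}cc Q Q' a : le Q Q' -> le Q' (m a) -> c Q (m a) = (c Q Q' * c Q' (m a))%g.
  by move=> QQ' Q'a; apply: cc => //; rewrite -ltnS -Pn; case: (mP a).
(* For disjoint [a] and [b], the factor between [c Q (m a)] and [c Q (m b)] does not depend on [Q]:
   it is read off at the finest common coarsening [R]. *)
have [t tE] : {t : M * M -> H & forall p, dj p.1 p.2 ->
    forall Q, le Q (m p.1) -> le Q (m p.2) -> c Q (m p.2) = (c Q (m p.1) * t p)%g}.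
  apply: (@choice _ _ (fun p g => dj p.1 p.2 -> forall Q, le Q (m p.1) ->
    le Q (m p.2) -> c Q (m p.2) = (c Q (m p.1) * g)%g)) => -[a b] /=.
  have [/mmeet[R [Ra Rb RM]]|ndj] := pselect (dj a b).
    exists ((c R (m a))^-1 * c R (m b))%g => _ Q Qa Qb.
    by rewrite (cc Q R a) ?(cc Q R b) ?mulgA ?mulgK //; apply: RM.
  by exists 1%g => /ndj.
have tM a b e : dj a b -> dj a e -> dj b e -> (t (a, e) = t (a, b) * t (b, e))%g.
  move=> ab ae be; have [R [Ra Rb Re]] := mtri _ _ _ ab ae be.
  apply: (mulgI (c R (m a))); rewrite -(tE (a, e)) // mulgA.
  by rewrite -(tE (a, b)) // -(tE (b, e)).
(* [F a] transports from [a] to the base point [a0] through a common neighbour [x]. Two choices [x]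
   and [y] are compared through a common neighbour [z] of [a], [a0], [x] and [y]; this is why four
   merges must have one. *)
have [F FE] : {F : M -> H & forall a x, dj x a -> dj x a0 ->
    F a = (t (a, x) * t (x, a0))%g}.
  apply: (@choice _ _ (fun a g => forall x, dj x a -> dj x a0 ->
    g = (t (a, x) * t (x, a0))%g)) => a.
  have [x [xa xa0 _ _]] := mdj a a0 a a.
  exists (t (a, x) * t (x, a0))%g => y ya ya0.
  have [z [za za0 zx zy]] := mdj a a0 x y.
  rewrite (tM a z x) -?mulgA -?(tM z x a0) //; try by apply: djC.
  by rewrite (tM z y a0) // mulgA -(tM a z y) //; apply: djC.
(* The link of P is simply connected: the cocycle t on it is a coboundary. *)
have FM a b : dj a b -> F a = (t (a, b) * F b)%g.
  move=> ab; have [z [za zb za0 _]] := mdj a b a0 a0.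
  by rewrite (FE a z) // (FE b z) // mulgA -(tM a b z) //; apply: djC.
have FQ a b Q : le Q (m a) -> le Q (m b) ->
    (c Q (m a) * F a = c Q (m b) * F b)%g.
  move=> Qa Qb; have [mab|ab] := mcase a b Q Qa Qb; last first.
    by rewrite (FM a b) // mulgA -(tE (a, b)).
  (* Different indices may give the same merge; then [t (a, z)] and [t (b, z)] agree, both being
     determined by [c] at a common coarsening with [m z]. *)
  have [z [za zb _ _]] := mdj a b a b; have [az bz] := (djC _ _ za, djC _ _ zb).
  rewrite mab (FM a z) // (FM b z) //; congr (_ * (_ * _))%g.
  have [R [Ra Rz _]] := mmeet _ _ az; apply: (mulgI (c R (m a))).
  by rewrite -(tE (a, z)) // mab -(tE (b, z)) //= -mab.
have [cP cPE] : {cP : T -> H & forall Q a, le Q (m a) ->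
    cP Q = (c Q (m a) * F a)%g}.
  apply: (@choice _ _ (fun Q g => forall a, le Q (m a) -> g = (c Q (m a) * F a)%g)) => Q.
  have [[a Qa]|na] := pselect (exists a, le Q (m a)).
    by exists (c Q (m a) * F a)%g => b Qb; exact: FQ.
  by exists 1%g => a Qa; case: na; exists a.
exists cP => Q Q' QQ' Q'P neP; have [a Q'a] := mex Q' Q'P neP.
by rewrite !(cPE _ a) ?(cc Q Q') ?mulgA //; apply: le_trans Q'a.
Qed.

(** Comparable elements of equal rank are equal, so the elements of rank [M.+1] do not interact and
    each gets its values from [cocycle_top] separately. *)
Lemma cocycle_extend (N M : nat) c :
  (forall P, N < rk P -> flexible P) -> cocycle N c ->
  exists2 c', cocycle M c' & forall P Q, rk Q <= N -> c' P Q = c P Q.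
Proof.
move=> flex cN; elim: M => [|M [c' cM c'E]].
  by exists c => // P Q R PQ QR R0; apply: cN => //; apply: leq_trans R0 _.
have [MN|NM] := ltnP M N.
  by exists c => // P Q R PQ QR RM; apply: cN => //; apply: leq_trans RM _.
have [top topE] : {top : T -> T -> H & forall P, rk P = M.+1 ->
    forall Q Q', le Q Q' -> le Q' P -> Q' <> P ->
    top P Q = (c' Q Q' * top P Q')%g}.
  apply: (@choice _ _ (fun P (cP : T -> H) => rk P = M.+1 ->
    forall Q Q', le Q Q' -> le Q' P -> Q' <> P -> cP Q = (c' Q Q' * cP Q')%g)) => P.
  have [PM|nPM] := pselect (rk P = M.+1); last by exists (fun=> 1%g).
  have [|cP cPE] := cocycle_top cM _ PM; first by apply: flex; rewrite PM ltnS.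
  by exists cP.
pose c2 P Q : H := if rk Q <= M then c' P Q else
  if pselect (P = Q) then 1%g else top Q P.
exists c2 => [P Q R PQ QR|P Q QN]; last first.
  by rewrite /c2 (leq_trans QN NM) c'E.
rewrite leq_eqVlt => /orP[/eqP RM|]; last first.
  by rewrite ltnS => RM; rewrite /c2 (leq_trans (rk_le QR) RM) RM; apply: cM.
have [QR'|neQR] := pselect (Q = R).
  have -> : c2 Q R = 1%g.
    by rewrite /c2 RM ltnn; case: pselect.
  by rewrite QR' mulg1.
have QM : rk Q <= M.
  rewrite -ltnS -RM ltn_neqAle rk_le // andbT.
  by apply/eqP => /(rk_eq QR).
have c2R X : X <> R -> c2 X R = top R X.
  by rewrite /c2 RM ltnn; case: pselect.
rewrite !c2R // => [|PR]; last by case: neQR; apply: le_anti => //; rewrite -PR.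
by rewrite {1}/c2 QM; apply: topE.
Qed.

End Cocycles.
(** * Presentation of a group acting on a directed poset *)

Section ActionPresentation.
Variables (T : Type) (le : T -> T -> Prop) (rk : T -> nat).
Hypothesis le_refl : forall P, le P P.
Hypothesis le_trans : forall P Q R, le P Q -> le Q R -> le P R.
Hypothesis le_anti : forall P Q, le P Q -> le Q P -> P = Q.
Hypothesis rk_le : forall P Q, le P Q -> rk P <= rk Q.
Hypothesis rk_eq : forall P Q, le P Q -> rk P = rk Q -> P = Q.
Hypothesis directed : forall P Q, exists R, le P R /\ le Q R.

Variables (G : groupType) (act : G -> T -> T).
Hypothesis act1 : forall P, act 1%g P = P.
Hypothesis actM : forall g h P, act (g * h)%g P = act g (act h P).
Hypothesis le_act : forall g P Q, le P Q -> le (act g P) (act g Q).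
Hypothesis rk_act : forall g P, rk (act g P) = rk P.

Variable P0 : T.
Hypothesis flex : forall P, rk P0 < rk P -> flexible le rk P.
Hypothesis cofinal : forall P, rk P <= rk P0 -> exists g, le P (act g P0).

Definition step_set : set G := [set g | exists2 P, le P P0 & le P (act g P0)].

Let adj (g h : G) := exists2 P, le P (act g P0) & le P (act h P0).

Let adjE g h : adj g h <-> step_set (g^-1 * h)%g.
Proof.
split=> [[P Pg Ph]|[P PP0 Pgh]].
  exists (act g^-1%g P); last by rewrite actM; apply: le_act.
  by rewrite -[P0]act1 -(mulVg g) actM; apply: le_act.
exists (act g P); first exact: le_act.
by rewrite -[h](mulKVg g) actM; apply: le_act.
Qed.

Let step1 : step_set 1%g. Proof. by exists P0; rewrite ?act1. Qed.

Let stepV g : step_set g -> step_set g^-1%g.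
Proof.
move=> sg; rewrite -[X in step_set X]mulg1; apply/adjE.
have [P Pg P1] : adj 1%g g by apply/adjE; rewrite invg1 mul1g.
by exists P.
Qed.

Let v (s : step_set) : G := val s.
Let Rel := [set r : gword step_set | size r <= 3 /\ gword_eval v r = 1%g].

(** This choice of translates of [P0] turns a function of pairs in [G] into a function of pairs in
    the poset; its values above the rank of [P0] are irrelevant. *)
Let sec_ex : {s : T -> G & forall P, rk P <= rk P0 -> le P (act (s P) P0)}.
Proof.
apply: (@choice _ _ (fun P g => rk P <= rk P0 -> le P (act g P0))) => P.
have [/cofinal[g Pg]|nP] := pselect (rk P <= rk P0); first by exists g.
by exists 1%g.
Qed.
Let s := projT1 sec_ex.
Let sP P : rk P <= rk P0 -> le P (act (s P) P0) := projT2 sec_ex P.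

(** Apply [connected_below] under a common refinement of [P0] and [g P0], the relation being that
    the chosen group elements differ by a product of steps. *)
Lemma step_set_gen g : exists w, gword_eval v w = g.
Proof.
pose Gam (x : G) := exists w, gword_eval v w = x.
have GamM x y : Gam x -> Gam y -> Gam (x * y)%g.
  by move=> [w1 <-] [w2 <-]; exists (w1 ++ w2); rewrite gword_eval_cat.
have GamS x : step_set x -> Gam x.
  by move=> /mem_set Sx; exists [:: (exist _ x Sx, true)]; rewrite /= mulg1.
have GamV x : Gam x -> Gam x^-1%g.
  move=> [w <-]; elim: w => [|[y b] w IHw] /=; first by rewrite invg1; apply: GamS.
  rewrite invgM; apply: GamM => //; apply: GamS.
  have Sy : step_set (v y) by apply: set_mem; exact: (valP y).
  by case: b; rewrite ?invgK //; apply: stepV.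
have GamA x y : adj x y -> Gam (x^-1 * y)%g by move/adjE; apply: GamS.
have rkg x : rk (act x P0) <= rk P0 by rewrite rk_act.
have [R [R1 Rg]] := directed P0 (act g P0).
have : Gam ((s P0)^-1 * s (act g P0))%g.
  apply: (@connected_below _ le rk le_refl le_trans (rk P0)
    (fun P Q => Gam ((s P)^-1 * s Q)%g) flex _ _ _ R) => //.
  - by move=> P Q /GamV; rewrite invgM invgK.
  - by move=> P Q S PQ QS; rewrite -[s S](mulKVg (s Q)) mulgA; apply: GamM.
  - move=> P Q PQ QN; apply: GamA; exists P; first exact/sP/(leq_trans (rk_le PQ)).
    exact/(le_trans PQ)/sP.
move=> H; have -> : g = ((1^-1 * s P0) * ((s P0)^-1 * s (act g P0)) *
    ((s (act g P0))^-1 * g))%g.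
  by rewrite invg1 mul1g mulKVg mulKVg.
apply: (GamM); first apply: (GamM) => //.
  by apply: GamA; exists P0; [rewrite act1|exact: sP].
by apply: GamA; exists (act g P0); first exact: sP.
Qed.

Section Homomorphism.
Variables (H : groupType) (u : step_set -> H).
Hypothesis uR : forall r, Rel r -> gword_eval u r = 1%g.

Let k (g : G) : H := if pselect (step_set g) is left Sg
  then u (exist _ g (mem_set Sg)) else 1%g.

Let kE (x : step_set) : k (v x) = u x.
Proof.
rewrite /k; case: pselect => [Sx|[]]; last by apply: set_mem; exact: (valP x).
by congr u; apply: val_inj.
Qed.

Let step_lift g : step_set g -> exists x, v x = g.
Proof. by move=> /mem_set Sg; exists (exist _ g Sg). Qed.

Let kM g h : step_set g -> step_set h -> step_set (g * h)%g ->
  k (g * h)%g = (k g * k h)%g.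
Proof.
move=> /step_lift[x <-] /step_lift[y <-] /step_lift[z zE]; rewrite -zE !kE.
(* Relators [x y z^-1] make [u] multiplicative as long as the product of two steps is a step. *)
have : Rel [:: (x, true); (y, true); (z, false)].
  by split=> //=; rewrite zE mulg1 mulgA mulgV.
by move/uR; rewrite /= mulg1 mulgA => /(canRL (mulgKV _)); rewrite mul1g.
Qed.

Let kV g : step_set g -> k g^-1%g = (k g)^-1%g.
Proof.
move=> Sg; have k1 : k 1%g = 1%g.
  by apply: (mulgI (k 1%g)); rewrite -kM ?mulg1 //.
by apply: (mulgI (k g)); rewrite -kM ?mulgV //; apply: stepV.
Qed.

Let c g h := k (g^-1 * h)%g.

Let cM g h j P : le P (act g P0) -> le P (act h P0) -> le P (act j P0) ->
  c g j = (c g h * c h j)%g.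
Proof.
move=> Pg Ph Pj; rewrite /c -[X in (_ * X)%g](mulKVg h) mulgA kM //.
- by apply/adjE; exists P.
- by apply/adjE; exists P.
- by rewrite -mulgA mulKVg; apply/adjE; exists P.
Qed.

(** Let [Q] be finer than [g P0] for all prefixes [g] of [w]. Extended up to the rank of [Q], the
    cocycle given by [u] becomes a coboundary on the coarsenings of [Q], so its product along the
    closed path traced by [w] is trivial. *)
Lemma step_set_relations w : gword_eval v w = 1%g -> gword_eval u w = 1%g.
Proof.
move=> w1.
(* The neutral factor is generalized to an arbitrary starting point in the induction on [w]. *)
have [Q Qw] : exists Q, forall n, le (act (1 * gword_eval v (take n w))%g P0) Q.
  elim: (w) (1%g) => [|[x b] w' IHw] g.
    by exists (act (g * 1)%g P0) => -[].
  have [Q1 Q1w] := IHw (g * (if b then v x else (v x)^-1))%g.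
  have [Q [Qg Q1Q]] := directed (act g P0) Q1; exists Q => -[|n] /=.
    by rewrite mulg1.
  by rewrite mulgA; apply: le_trans Q1Q.
have cN : cocycle le rk (rk P0) (fun P Q => c (s P) (s Q)).
  move=> P P' R PP' P'R RN; have P'N := leq_trans (rk_le P'R) RN.
  apply: (@cM _ _ _ P); first exact/sP/(leq_trans (rk_le PP')).
    exact/(le_trans PP')/sP.
  by apply: (le_trans PP'); apply: (le_trans P'R); apply: sP.
have [c' cc' c'E] := cocycle_extend le_trans le_anti rk_le rk_eq (rk Q) flex cN.
(* The first factor corrects for [s (act g P0)] being possibly different from [g]; by [phiP], any
   coarsening of [g P0] can replace [g P0] in this formula. *)
pose phi g := (c g (s (act g P0)) * c' (act g P0) Q)%g.
have phiP g P : le P (act g P0) -> le (act g P0) Q ->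
    phi g = (c g (s P) * c' P Q)%g.
  move=> Pg gQ; have gN : rk (act g P0) <= rk P0 by rewrite rk_act.
  have PN := leq_trans (rk_le Pg) gN.
  rewrite (cc' P (act g P0) Q) // c'E // mulgA -(@cM _ _ _ P) //; first exact: sP.
  exact/(le_trans Pg)/sP.
have phiM g h : adj g h -> le (act g P0) Q -> le (act h P0) Q ->
    phi g = (c g h * phi h)%g.
  move=> [P Pg Ph] gQ hQ; rewrite (phiP g P) // (phiP h P) // mulgA -(@cM _ _ _ P) //.
  by apply: sP; rewrite (leq_trans (rk_le Pg)) ?rk_act.
(* phi trivializes the cocycle c along the path of prefixes of w. *)
have phiw : phi 1%g = (gword_eval u w * phi (1 * gword_eval v w))%g.
  elim: (w) (1%g) Qw => [|[x b] w' IHw] g Qw /=; first by rewrite mul1g mulg1.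
  pose y : G := (if b then v x else (v x)^-1)%g; rewrite -/y.
  have Sx : step_set (v x) by apply: set_mem; exact: (valP x).
  have Sy : step_set y by rewrite /y; case: (b) => //; apply: stepV.
  have ky : (if b then u x else (u x)^-1)%g = k y.
    by rewrite /y; case: (b); rewrite ?kV ?kE.
  rewrite ky [(g * (y * _))%g]mulgA -[LHS]/(phi g) (@phiM g (g * y)%g).
  - by rewrite /c mulKg -[RHS]mulgA -IHw // => n; have := Qw n.+1; rewrite /= mulgA.
  - by apply/adjE; rewrite mulKg.
  - by have := Qw 0; rewrite /= mulg1.
  - by have := Qw 1; rewrite /= take0 /= mulg1.
by apply: (mulIg (phi 1%g)); rewrite mul1g {2}phiw w1 mulg1.
Qed.
End Homomorphism.

Lemma action_presentation :
  is_presentation (fun x : step_set => val x)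
    [set r : gword step_set | size r <= 3 /\ gword_eval (fun x => val x) r = 1%g].
Proof.
apply: is_presentationP => [g|r [] //|H u uR w w1]; first exact: step_set_gen.
exact: step_set_relations uR w w1.
Qed.

End ActionPresentation.
(** * Compactness of W_k(D) *)

Lemma filter_forall_seq (X : Type) (Y : eqType) (F : set_system X) (s : seq Y)
    (P : Y -> X -> Prop) :
  Filter F -> (forall y, y \in s -> F (P y)) ->
  F [set x | forall y, y \in s -> P y x].
Proof.
move=> FF; elim: s => [|y s IHs] sF; first by apply: filterS filterT => x _ y.
have Fs : F [set x | forall z, z \in s -> P z x].
  by apply: IHs => z zs; apply: sF; rewrite inE zs orbT.
apply: filterS (filterI (sF y (mem_head _ _)) Fs) => x [Py Ps] z.
by rewrite inE => /orP[/eqP ->|/Ps].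
Qed.

Lemma ultra_finite (X : Type) (Y : eqType) (f : X -> Y) (s : seq Y) (F : set_system X) :
  UltraFilter F -> (forall x, f x \in s) -> exists y, F [set x | f x = y].
Proof.
move=> FU fs; apply: contrapT => nF.
have FC y : F (~` [set x | f x = y]).
  by have [Fy|//] := in_ultra_setVsetC [set x | f x = y] FU; case: nF; exists y.
have FF' : Filter F by exact: filter_filter.
have /filter_ex [x] := filter_forall_seq (s := s) FF' (fun y _ => FC y).
by move/(_ _ (fs x)); apply.
Qed.

(** Automorphisms preserve levels, so reading the inverses off at the same index [level v] gives the
    inverse of the limit. *)
Lemma tree_aut_limit (T : rtree) (x : nat -> tree_aut T) :
  (forall m n (v : T), m <= n -> level v <= m -> x n v = x m v) ->
  exists f : tree_aut T, forall n (v : T), level v <= n -> f v = x n v.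
Proof.
move=> xE; pose f v := x (level v) v; pose f' v := aut_fun (x (level v))^-1%g v.
have xV m n v : m <= n -> level v <= m -> aut_fun (x n)^-1%g v = aut_fun (x m)^-1%g v.
  move=> mn vm; apply: (@aut_inj _ (x n)); rewrite autVK (xE m n) ?autVK //.
  by rewrite aut_level.
have fK : cancel f f' by move=> v; rewrite /f' /f aut_level autK.
have f'K : cancel f' f by move=> v; rewrite /f' /f aut_level autVK.
have f0 : f troot = troot by exact: aut_root.
have fc u v : child u v -> child (f u) (f v).
  move=> uv; rewrite /f (level_child uv) -(xE _ _ _ (leqnSn _)) //.
  exact: aut_child.
have f'c u v : child u v -> child (f' u) (f' v).
  move=> uv; rewrite /f' (level_child uv) -(xV _ _ _ (leqnSn _)) //.
  exact: aut_child.
exists (mk_aut fK f'K f0 fc f'c) => n v vn.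
by rewrite (xE (level v) n).
Qed.

(** An ultrafilter decides the image of each vertex, since levels are finite. The resulting images
    form an automorphism, which lies in [Wk_set] because, by [WDP], membership in W(D) is a
    condition at each vertex and its children. *)
Lemma Wk_stab_compact k d (D : {group 'S_d}) n : compact (@Wk_stab k d D n).
Proof.
rewrite compact_ultra => F FU Fn; have FF' : Filter F by exact: filter_filter.
have finl m : exists s : seq (option (node k d)),
    forall v : Tdk k d, level v <= m <-> (v : option (node k d)) \in s.
  have /finite_seqP[s sE] := @finite_level k d m; exists s => v.
  by change ([set u : Tdk k d | level u <= m] v <-> [set` s] v); rewrite sE.
have [u uF] : {u : Tdk k d -> Tdk k d & forall v, F [set y : Wk k D | aut_fun (val y) v = u v]}.
  apply: (@choice _ _ (fun v w => F [set y : Wk k D | aut_fun (val y) v = w])) => v.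
  have [s sE] := finl (level v).
  apply: (@ultra_finite _ _ (fun y : Wk k D => aut_fun (val y) v : option (node k d)) s).
  by move=> y; apply/sE; rewrite aut_level.
have {}uF m : F [set y : Wk k D | forall v, level v <= m -> aut_fun (val y) v = u v].
  have [s sE] := finl m.
  have := filter_forall_seq (s := s) FF' (fun v _ => uF v).
  by apply: filterS => y ys v /sE /ys.
have [x xE] : {x : nat -> Wk k D & forall m v, level v <= m -> aut_fun (val (x m)) v = u v}.
  apply: (@choice _ _ (fun m (y : Wk k D) => forall v, level v <= m -> aut_fun (val y) v = u v)).
  by move=> m; have [y] := filter_ex (uF m); exists y.
have [f fE] : exists f : tree_aut (Tdk k d), forall m v, level v <= m ->
    f v = aut_fun (val (x m)) v.
  apply: tree_aut_limit => m p v mp vm.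
  by rewrite !xE // (leq_trans vm).
have Wf : Wk_set D f.
  (* The index is [m.+1] because the vertex [(a, w)] has level one more than [w]. *)
  move=> a; have [g gE] : {g : nat -> tree_aut (Td d) & forall m,
      sg_set (WD D) (g m) /\ forall w, aut_fun (val (x m.+1)) (Some (a, w)) = Some (a, g m w)}.
    apply: (@choice _ _ (fun m (h : tree_aut (Td d)) => sg_set (WD D) h /\
      forall w, aut_fun (val (x m.+1)) (Some (a, w)) = Some (a, h w))) => m.
    by have [h Wh hE] := sg_valP (x m.+1) a; exists h.
  have gf m w : size w <= m -> f (Some (a, w)) = Some (a, g m w).
    by move=> wm; rewrite (fE m.+1) //; case: (gE m).
  have [h hE] : exists h : tree_aut (Td d), forall m v, level v <= m -> h v = g m v.
    apply: tree_aut_limit => m p v mp vm.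
    have := gf m v vm; rewrite (gf p v) ?(leq_trans vm) //.
    by move=> [].
  exists h => [|w]; last by rewrite (hE (size w)) // -gf.
  (* The local permutation at [v] is visible on the children of [v], at level [(size v).+1]. *)
  apply/WDP => v; have [/WDP/(_ v)[s Ds sE] _] := gE (size v).+1.
  exists s => // y; rewrite (hE (size v).+1) /= ?size_rcons // sE.
  by rewrite (hE (size v).+1) /= ?leqnSn.
exists (sg_elt (H := Wk_sg k D) Wf); split.
  have [y [yn yu]] := filter_ex (filterI Fn (uF n)).
  by move=> v vn; rewrite /= (fE n) // xE // -yu // yn.
move=> A [m Am]; apply: filterS (uF m) => y yu.
rewrite -[y](mulKVg (sg_elt (H := Wk_sg k D) Wf)); apply: Am => v vm.
apply: (@aut_inj _ f); rewrite -autME.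
have -> : (f * val ((sg_elt (H := Wk_sg k D) Wf)^-1 * y)%g)%g = val y.
  by rewrite -[y in RHS](mulKVg (sg_elt (H := Wk_sg k D) Wf)).
by rewrite yu // (fE m) // xE.
Qed.
(** * Partitions of the boundary into balls *)

Section Charts.
Variables (k d : nat) (D : {group 'S_d}).
Hypothesis d_gt1 : 1 < d.
Notation W := (sg_set (WD D)).
Notation bray := (nat -> 'I_d).
Notation chart := (bray -> ray k d).
Implicit Types (w u t : seq 'I_d) (h : tree_aut (Td d)) (b c : bray) (e f : chart).

Let W1 : W 1%g := sg_one (WD D).

Let x0 : 'I_d := Ordinal (ltnW d_gt1).
Let b0 : bray := fun=> x0.

(** * Words, charts and sub-balls *)

Lemma catr_prefix w u b c : catr w b = catr u c -> size w <= size u ->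
  exists t, u = w ++ t.
Proof.
move=> E wu; exists (drop (size w) u).
rewrite -[LHS](cat_take_drop (size w)); congr (_ ++ _).
by rewrite -(mkseq_catr_take c wu) -E mkseq_catr_take // take_size.
Qed.

Lemma catr_cons_head w x t b c : catr w b = catr (w ++ x :: t) c -> b 0 = x.
Proof. by rewrite catr_cat => /catr_inj[] // _ ->. Qed.

Lemma exists_neq_ord (x : 'I_d) : exists y : 'I_d, y <> x.
Proof.
have [->|x0x] := eqVneq x x0; last by exists x0 => /eqP; rewrite eq_sym (negPf x0x).
by exists (Ordinal d_gt1) => /(congr1 val).
Qed.

Definition shift w h : bray -> bray := fun b => catr w (ray_act h b).

Lemma shift1 w b : shift w 1%g b = catr w b.
Proof. by rewrite /shift ray_act1. Qed.

Lemma shift_nil h b : shift [::] h b = ray_act h b.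
Proof. exact: catr0. Qed.

(** W(D) is self-similar: [h'] is the section of [h] at [u]. *)
Lemma shift_comp w h u : W h -> exists2 h', W h' &
  forall h2 b, shift w h (shift u h2 b) =
    shift (w ++ (aut_fun h u : seq 'I_d)) (h' * h2)%g b.
Proof.
move=> Wh; have [h' Wh' hE] := WD_section u Wh; exists h' => // h2 b.
by rewrite /shift (ray_act_catr _ hE) ray_actM catr_cat.
Qed.

Lemma shift_factor w t h h' : W h -> W h' ->
  exists u h2, W h2 /\ forall b, shift (w ++ t) h' b = shift w h (shift u h2 b).
Proof.
move=> Wh Wh'; have [h1 Wh1 E] := shift_comp w (aut_fun h^-1%g t) Wh.
exists (aut_fun h^-1%g t), (h1^-1 * h')%g; split.
  by apply: sg_mul => //; exact: sg_inv.
by move=> b; rewrite E autVK mulKVg.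
Qed.

(** Charts of the sub-balls of the ball [e], compatible with [e] up to W(D); the empty word gives
    the reparametrizations of [e] itself. *)
Definition sub_chart e : set chart :=
  [set f | exists w, exists2 h, W h & forall b, f b = e (shift w h b)].

Lemma sub_chart_refl e : sub_chart e e.
Proof. by exists [::], 1%g => // b; rewrite shift1 catr0. Qed.

Lemma sub_chart_trans e f g : sub_chart e f -> sub_chart f g -> sub_chart e g.
Proof.
move=> [w [h Wh fE]] [u [h2 Wh2 gE]].
have [h' Wh' hE] := shift_comp w u Wh.
exists (w ++ (aut_fun h u : seq 'I_d)), (h' * h2)%g => [|b]; first exact: sg_mul.
by rewrite gE fE hE.
Qed.

Lemma sub_chart_shift e w h : W h -> sub_chart e (e \o shift w h).
Proof. by move=> Wh; exists w, h. Qed.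

Lemma sub_chart_cat e f g w t h h' : W h -> W h' ->
  (forall b, f b = e (shift w h b)) -> (forall b, g b = e (shift (w ++ t) h' b)) ->
  sub_chart f g.
Proof.
move=> Wh Wh' fE gE; have [u [h2 [Wh2 E]]] := shift_factor w t Wh Wh'.
by exists u, h2 => // b; rewrite gE fE E.
Qed.

Lemma sub_chart_comp (g : ray k d -> ray k d) e f :
  sub_chart e f -> sub_chart (g \o e) (g \o f).
Proof. by move=> [w [h Wh fE]]; exists w, h => // b; rewrite /= fE. Qed.

(* The image of a framing is a partition of the boundary into balls, each one
   identified with the boundary of T_d. *)
Definition framing (I : finType) (phi : I -> chart) :=
  (forall r, exists i b, phi i b = r) /\
  (forall i j b c, phi i b = phi j c -> i = j /\ b = c).

Definition span (I : finType) (phi : I -> chart) : set chart :=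
  [set f | exists i, sub_chart (phi i) f].

Lemma span_id (I : finType) (phi : I -> chart) i : span phi (phi i).
Proof. by exists i; exact: sub_chart_refl. Qed.

Lemma span_sub (I : finType) (phi : I -> chart) e f :
  span phi e -> sub_chart e f -> span phi f.
Proof. by move=> [i ie] ef; exists i; exact: sub_chart_trans ef. Qed.

Lemma span_subset (I J : finType) (phi : I -> chart) (psi : J -> chart) :
  (forall i, span psi (phi i)) -> span phi `<=` span psi.
Proof. by move=> H f [i]; exact: span_sub. Qed.

Section Framing.
Variables (I : finType) (phi : I -> chart).
Hypothesis fphi : framing phi.

Lemma framing_meet i j w u b c : phi i (catr w b) = phi j (catr u c) ->
  size w <= size u -> i = j /\ exists t, u = w ++ t.
Proof.
move=> E wu; have [_ inj] := fphi; have [-> /catr_prefix H] := inj _ _ _ _ E.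
by split=> //; apply: H.
Qed.

(** One word must be a prefix of the other, and a proper prefix would give a strictly larger
    ball. *)
Lemma framing_word i j w u h h' :
  (forall b, phi i (shift w h b) = phi j (shift u h' b)) -> i = j /\ w = u.
Proof.
move=> E; wlog wu : i j w u h h' E / size w <= size u.
  move=> H; have [wu|/ltnW uw] := leqP (size w) (size u); first exact: H E wu.
  by have [-> ->] := H j i u w h' h (fun b => esym (E b)) uw.
have [ij [t ut]] := framing_meet (E b0) wu; split=> //.
case: t ut => [|x t] ut; first by rewrite ut cats0.
have [y yx] := exists_neq_ord x.
have := E (ray_act h^-1%g (fun=> y)); case: fphi => _ /[apply] -[_].
by rewrite ut /shift ray_actVK => /catr_cons_head.
Qed.

Lemma framing_cover (J : finType) (psi : J -> chart) : framing psi ->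
  forall (f : I -> J), (forall i, exists w h, forall b, phi i b = psi (f i) (shift w h b)) ->
  forall j, exists i, f i = j.
Proof.
move=> fpsi f fE j; case: fphi => /(_ (psi j b0))[i [b ib]] _.
have [w [h iE]] := fE i; exists i.
by move: ib; rewrite iE; case: fpsi => _ /[apply] -[].
Qed.
End Framing.

Lemma span_choice (I J : finType) (phi : I -> chart) (psi : J -> chart) :
  span phi `<=` span psi -> exists (q : I -> J * seq 'I_d * tree_aut (Td d)),
    forall i, W (q i).2 /\ forall b, phi i b = psi (q i).1.1 (shift (q i).1.2 (q i).2 b).
Proof.
move=> sub; have [q qE] : {q : I -> J * seq 'I_d * tree_aut (Td d) & forall i,
    W (q i).2 /\ forall b, phi i b = psi (q i).1.1 (shift (q i).1.2 (q i).2 b)}.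
  apply: (@choice _ _ (fun i (q : J * seq 'I_d * tree_aut (Td d)) =>
    W q.2 /\ forall b, phi i b = psi q.1.1 (shift q.1.2 q.2 b))) => i.
  by have [j [w [h Wh E]]] := sub _ (span_id phi i); exists (j, w, h).
by exists q.
Qed.

(** Sending a ball of [phi] to the ball of [psi] containing it is surjective, whence the inequality.
    If it is bijective, each ball of [psi] contains a single ball of [phi], hence equals it. *)
Lemma framing_rank (I J : finType) (phi : I -> chart) (psi : J -> chart) :
  framing phi -> framing psi -> span phi `<=` span psi ->
  #|J| <= #|I| /\ (#|I| <= #|J| -> span phi = span psi).
Proof.
move=> fphi fpsi sub; have [q qE] := span_choice sub.
have surj j : exists i, (q i).1.1 = j.
  apply: (framing_cover fphi fpsi) => i; exists (q i).1.2, (q i).2.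
  by case: (qE i).
pose f i := (q i).1.1.
have fT : codom f =i predT.
  by move=> j; have [i <-] := surj j; rewrite codom_f.
have JI : #|J| <= #|I| by rewrite -(eq_card fT) leq_image_card.
split=> // IJ; apply/seteqP; split=> //; apply: span_subset => j.
have /image_injP finj : #|codom f| == #|I|.
  by rewrite (eq_card fT) eqn_leq JI.
have {surj}[i ij] := surj j; have [Wi iE] := qE i; rewrite ij in iE.
case qw : (q i).1.2 iE => [|x w] iE.
  exists i, [::], (q i).2^-1%g => [|b]; first exact: sg_inv.
  by rewrite iE !shift_nil ray_actVK.
have [y yx] := exists_neq_ord x; have [/(_ (psi j (fun=> y)))[i' [b i'b]] _] := fphi.
have [_ inj] := fpsi; have [_ i'E] := qE i'; rewrite i'E in i'b.
have [i'j _] := inj _ _ _ _ i'b.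
have i'i : i' = i by apply: finj => //; rewrite /f ij.
move: i'b; rewrite -i'E i'i iE => /inj[_] E.
by case: yx; apply: (@catr_cons_head [::] x w (fun=> y) (ray_act (q i).2 b)); rewrite catr0 -E.
Qed.

(** * Merging d balls into one *)

Lemma glue_children (s : 'I_d -> tree_aut (Td d)) : (forall y, W (s y)) ->
  exists2 h, W h & forall y b, ray_act h (catr [:: y] b) = catr [:: y] (ray_act (s y) b).
Proof.
move=> Ws; have [h Wh hE] := WD_glue 1 (fun u => Ws (head x0 u)).
exists h => // y b; rewrite (@ray_act_catr _ h (s y)) => [|u].
  by rewrite hE /= td_nil.
by rewrite !hE /= !take0 !drop0 td_nil.
Qed.

Lemma bray_cons b : catr [:: b 0] (fun n => b n.+1) = b.
Proof. exact/esym/(catr_split b 1). Qed.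

(** Makes the balls [phi (e x)] the children of a new ball, although in general they are not
    siblings in the tree. *)
Definition join (I : Type) (phi : I -> chart) (e : 'I_d -> I) : chart :=
  fun b => phi (e (b 0)) (fun n => b n.+1).

Lemma join_cons (I : Type) (phi : I -> chart) (e : 'I_d -> I) x b :
  join phi e (catr [:: x] b) = phi (e x) b.
Proof.
rewrite /join; congr (phi _ _); apply/funext => n.
by rewrite /catr /= nth_nil subn1.
Qed.

Definition merged (I : finType) (phi : I -> chart) (e : 'I_d -> I)
    (o : option {i | i \notin codom e}) : chart :=
  if o is Some i then phi (val i) else join phi e.

Section Merge.
Variables (I : finType) (phi : I -> chart) (e : 'I_d -> I).
Hypotheses (fphi : framing phi) (inj_e : injective e).

Lemma framing_merged : framing (@merged I phi e).
Proof.
split=> [r|i j b c].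
  have [i [b <-]] := fphi.1 r.
  have [/codomP[x ->]|ie] := boolP (i \in codom e).
    by exists None, (catr [:: x] b); rewrite /= join_cons.
  by exists (Some (exist _ i ie)), b.
have ne (x : 'I_d) (j' : {i | i \notin codom e}) : e x <> val j'.
  by move=> ej; have := valP j'; rewrite -ej codom_f.
case: i j => [i|] [j|] /= /fphi.2[].
- by move=> ij ->; split=> //; congr Some; apply: val_inj.
- by move=> /esym/ne.
- by move=> /ne.
- move=> /inj_e bc0 bc; split=> //; rewrite -[b]bray_cons -[c]bray_cons bc0.
  by congr catr.
Qed.

Lemma span_merged : span (@merged I phi e) = span phi `|` sub_chart (join phi e).
Proof.
apply/seteqP; split=> f.
  by move=> [[i|] /= sf]; [left; exists (val i)|right].
move=> [[i sf]|sf]; last by exists None.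
have [/codomP[x ix]|ie] := boolP (i \in codom e); last first.
  by exists (Some (exist _ i ie)).
exists None; apply: sub_chart_trans sf; exists [:: x], 1%g => // b.
by rewrite /= shift1 join_cons ix.
Qed.

Lemma card_merged : #|{: option {i | i \notin codom e}}| = (#|I| - d).+1.
Proof.
rewrite card_option card_sig; congr _.+1.
have ed : #|codom e| = d by rewrite card_codom ?card_ord.
rewrite -(cardC (mem (codom e))) [X in X + _](_ : _ = d) ?addKn //.
Qed.
Lemma card_merged_lt : #|{: option {i | i \notin codom e}}| < #|I|.
Proof.
have dI : d <= #|I| by have := max_card (mem (codom e)); rewrite card_codom ?card_ord.
by rewrite card_merged -{2}(subnKC dI) -[X in X < _]add1n ltn_add2r.
Qed.
End Merge.

(** Take a ball of [phi] lying deepest inside its ball of [psi]. By maximality its siblings are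
    balls of [phi] as well, and these [d] balls merge into a ball inside a ball of [psi]. *)
Lemma merge_between (I J : finType) (phi : I -> chart) (psi : J -> chart) :
  framing phi -> framing psi -> span phi `<=` span psi -> span phi <> span psi ->
  exists2 e : 'I_d -> I, injective e & span psi (join phi e).
Proof.
move=> fphi fpsi sub neq; have [q qE] := span_choice sub.
pose w i := (q i).1.2; pose p i := (q i).1.1.
have [i0 wi0] : exists i, 0 < size (w i).
  apply: contrapT => nw; apply: neq; apply/seteqP; split=> //.
  apply: span_subset => j; have [i [b ib]] := fphi.1 (psi j b0).
  have [Wi iE] := qE i; have wi : (q i).1.2 = [::].
    by apply/eqP; rewrite -size_eq0; apply/negPn/negP; rewrite -lt0n => wi; apply: nw; exists i.
  move: ib; rewrite iE => /fpsi.2[<- _]; exists i, [::], (q i).2^-1%g => [|c].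
    exact: sg_inv.
  by rewrite iE wi !shift_nil ray_actVK.
have [i wi wmax] : exists2 i, 0 < size (w i) & forall i', size (w i') <= size (w i).
  case: (@arg_maxnP _ i0 predT (fun i => size (w i)) erefl) => i _ wmax.
  by exists i => [|i']; [exact: leq_trans (wmax i0 _)|exact: wmax].
have [u [x wE]] : exists u x, w i = rcons u x.
  by move: wi; case/lastP: (w i) => // u x _; exists u, x.
have [e eE] : {e : 'I_d -> I & forall y, p (e y) = p i /\ w (e y) = rcons u y}.
  apply: (@choice _ _ (fun y i' => p i' = p i /\ w i' = rcons u y)) => y.
  (* The ball [i'] meeting the sibling at [rcons u y] has a word no longer than [w i]. A shorter one
     would be a prefix of [u], and [i'] would meet the ball [i]. *)
  have [i' [b i'b]] := fphi.1 (psi (p i) (catr (rcons u y) b0)).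
  have [_ i'E] := qE i'; exists i'; move: i'b; rewrite i'E => i'b.
  have wi' : size (w i') <= size (rcons u y).
    by rewrite size_rcons -(size_rcons u x) -wE.
  have [pi' [t wt]] := framing_meet fpsi i'b wi'; split=> //.
  case/lastP: t wt => [|t z]; first by rewrite cats0.
  rewrite -rcons_cat => /rcons_inj[ut _].
  have [_ iE] := qE i; have := iE b0; rewrite -/(p i) -/(w i) wE ut rcons_cat.
  rewrite /shift catr_cat -{1}(ray_actVK (q i').2 (catr (rcons t x) _)).
  rewrite -/(shift _ _ _) -/(p i') -pi' -i'E => /fphi.2[ii' _].
  move: wE; rewrite ii' ut rcons_cat => /(congr1 size)/eqP.
  by rewrite size_cat size_rcons -{1}[size (w i')]addn0 eqn_add2l.
exists e => [y z eyz|].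
  by have := (eE y).2; rewrite eyz (eE z).2 => /rcons_inj[].
(* The charts of the siblings differ from the standard ones by elements of W(D), which glue to one
   element for the merged ball. *)
have [h Wh hE] := glue_children (fun y => (qE (e y)).1).
exists (p i), u, h => // b; have [_ eyE] := qE (e (b 0)).
rewrite /join eyE -/(p _) -/(w _) (eE (b 0)).1 (eE (b 0)).2 /shift.
by rewrite -cats1 catr_cat -hE bray_cons.
Qed.

(** Inside a common coarsening [psi] both merged balls are parents of the same ball, and a ball has
    only one parent. *)
Lemma overlapping_joins (I J : finType) (phi : I -> chart) (psi : J -> chart)
    (e e' : 'I_d -> I) x x' :
  framing psi -> span psi (join phi e) -> span psi (join phi e') -> e x = e' x' ->
  sub_chart (join phi e) (join phi e').
Proof.
move=> fpsi [j [u [h Wh eE]]] [j' [u' [h' Wh' e'E]]] exx'.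
have [h1 Wh1 E1] := shift_comp u [:: x] Wh.
have [h1' Wh1' E1'] := shift_comp u' [:: x'] Wh'.
have E b : psi j (shift (u ++ (aut_fun h [:: x] : seq 'I_d)) (h1 * 1)%g b) =
    psi j' (shift (u' ++ (aut_fun h' [:: x'] : seq 'I_d)) (h1' * 1)%g b).
  by rewrite -E1 -E1' -eE -e'E !shift1 !join_cons exx'.
have [jj' uu'] := framing_word fpsi E.
have {uu'}uu' : u = u'.
  have := congr1 (take (size u)) uu'; rewrite take_size_cat // => ->.
  have /eqP := congr1 size uu'; rewrite !size_cat !td_size eqn_add2r => /eqP ->.
  by rewrite take_size_cat.
exists [::], (h^-1 * h')%g; first by apply: sg_mul => //; exact: sg_inv.
by move=> b; rewrite eE e'E shift_nil ray_actM /shift ray_actVK jj' uu'.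
Qed.

Lemma sub_chart_sym e f h : W h -> (forall b, f b = e (ray_act h b)) -> sub_chart f e.
Proof.
move=> Wh fE; exists [::], h^-1%g => [|b]; first exact: sg_inv.
by rewrite fE shift_nil ray_actVK.
Qed.

Definition disjoint_maps (I : Type) (e e' : 'I_d -> I) := forall x y, e x <> e' y.

Lemma disjoint_maps_sym (I : Type) (e e' : 'I_d -> I) :
  disjoint_maps e e' -> disjoint_maps e' e.
Proof. by move=> H x y /esym/H. Qed.

Definition lift_map (I : finType) (e e' : 'I_d -> I) (H : forall x, e' x \notin codom e)
    (x : 'I_d) : option {i | i \notin codom e} := Some (exist _ (e' x) (H x)).

Lemma disjoint_mapsP (I : finType) (e e' : 'I_d -> I) :
  disjoint_maps e e' -> forall x, e' x \notin codom e.
Proof. by move=> H x; apply/negP => /codomP[y /esym/H]. Qed.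

Lemma lift_map_inj (I : finType) (e e' : 'I_d -> I) (H : forall x, e' x \notin codom e) :
  injective e' -> injective (lift_map H).
Proof. by move=> inj x y [/inj]. Qed.

Lemma lift_map_disjoint (I : finType) (e e1 e2 : 'I_d -> I)
    (H1 : forall x, e1 x \notin codom e) (H2 : forall x, e2 x \notin codom e) :
  disjoint_maps e1 e2 -> disjoint_maps (lift_map H1) (lift_map H2).
Proof. by move=> H x y [/H]. Qed.

Lemma meet2_framing (I : finType) (phi : I -> chart) (e1 e2 : 'I_d -> I) :
  framing phi -> injective e1 -> injective e2 -> disjoint_maps e1 e2 ->
  exists (J : finType) (psi : J -> chart), framing psi /\
    span psi = span phi `|` sub_chart (join phi e1) `|` sub_chart (join phi e2).
Proof.
move=> fphi i1 i2 /disjoint_mapsP H.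
exists (option {i | i \notin codom (lift_map H)}), (merged (@merged I phi e1) (e := lift_map H)).
by split; [apply: framing_merged; [apply: framing_merged|apply: lift_map_inj]|
  rewrite !span_merged].
Qed.

Lemma meet3_framing (I : finType) (phi : I -> chart) (e1 e2 e3 : 'I_d -> I) :
  framing phi -> injective e1 -> injective e2 -> injective e3 ->
  disjoint_maps e1 e2 -> disjoint_maps e1 e3 -> disjoint_maps e2 e3 ->
  exists (J : finType) (psi : J -> chart), framing psi /\
    span psi = span phi `|` sub_chart (join phi e1) `|` sub_chart (join phi e2)
      `|` sub_chart (join phi e3).
Proof.
move=> fphi i1 i2 i3 /disjoint_mapsP H2 /disjoint_mapsP H3 e23.
have [J [psi [fpsi psiE]]] := meet2_framing (framing_merged fphi i1)
  (lift_map_inj (H := H2) i2) (lift_map_inj (H := H3) i3)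
  (lift_map_disjoint (H1 := H2) (H2 := H3) e23).
by exists J, psi; rewrite psiE span_merged.
Qed.

(** * The directed poset of partitions *)

Definition std (a : 'I_k) w : chart := fun b => (a, catr w b).

(* Partitions coarser than the standard one at some level, that is, those which are
   piecewise of type W(D) with respect to T_(d,k). *)
Definition deep (A : set chart) := exists N, forall a w, N <= size w -> A (std a w).

Lemma deepS (A B : set chart) : A `<=` B -> deep A -> deep B.
Proof. by move=> AB [N NA]; exists N => a w /NA/AB. Qed.

(* A partition is encoded by the set of the charts of all sub-balls of its balls:
   this set does not depend on the choice of a framing, and refinement is reverse
   inclusion. *)
Definition is_part (A : set chart) (n : nat) :=
  deep A /\ exists (I : finType) (phi : I -> chart),
    [/\ #|I| = n, framing phi & A = span phi].

Record part := Part {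
  part_set : set chart; part_rank : nat; partP : is_part part_set part_rank }.

Definition coarser (P Q : part) := part_set Q `<=` part_set P.

Lemma part_framing P : exists (I : finType) (phi : I -> chart),
  [/\ #|I| = part_rank P, framing phi & part_set P = span phi].
Proof. by have [_] := partP P. Qed.

Lemma coarser_rank P Q : coarser P Q -> part_rank P <= part_rank Q.
Proof.
have [I [phi [<- fphi PE]]] := part_framing P.
have [J [psi [<- fpsi QE]]] := part_framing Q.
by rewrite /coarser PE QE => /(framing_rank fpsi fphi)[].
Qed.

Lemma coarser_eq_set P Q : coarser P Q -> part_rank P = part_rank Q ->
  part_set P = part_set Q.
Proof.
have [I [phi [<- fphi PE]]] := part_framing P.
have [J [psi [<- fpsi QE]]] := part_framing Q.
by rewrite /coarser PE QE => /(framing_rank fpsi fphi)[_ H] IJ; rewrite H ?IJ.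
Qed.

Lemma part_eq P Q : part_set P = part_set Q -> P = Q.
Proof.
move=> PQ; have rPQ : part_rank P = part_rank Q.
  by apply/eqP; rewrite eqn_leq !coarser_rank // /coarser PQ.
case: P Q PQ rPQ => A n HA [B m HB] /= AB nm; subst B m.
by congr Part; apply: Prop_irrelevance.
Qed.

Lemma coarser_refl P : coarser P P. Proof. by []. Qed.
Lemma coarser_trans P Q R : coarser P Q -> coarser Q R -> coarser P R.
Proof. by move=> PQ QR e /QR/PQ. Qed.
Lemma coarser_anti P Q : coarser P Q -> coarser Q P -> P = Q.
Proof. by move=> PQ QP; apply/part_eq/seteqP. Qed.
Lemma coarser_eq P Q : coarser P Q -> part_rank P = part_rank Q -> P = Q.
Proof. by move=> PQ rPQ; apply/part_eq/coarser_eq_set. Qed.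

Lemma merge_coarser P Q (I : finType) (phi : I -> chart) :
  framing phi -> part_set Q = span phi -> coarser P Q -> P <> Q ->
  exists2 e : 'I_d -> I, injective e & span (@merged I phi e) `<=` part_set P.
Proof.
move=> fphi QE PQ neq; have [J [psi [_ fpsi PE]]] := part_framing P.
have [||e inj_e eP] := merge_between fphi fpsi.
- by rewrite -QE -PE.
- by rewrite -QE -PE => QP; apply: neq; apply: part_eq.
exists e => //; rewrite span_merged -QE PE => f [/PQ|]; first by rewrite PE.
exact: span_sub.
Qed.

(** Four images of size at most [d] leave at least [d] of the [5 * d] indices free. *)
Lemma free_map (I : finType) (e1 e2 e3 e4 : 'I_d -> I) : 5 * d <= #|I| ->
  exists2 e : 'I_d -> I, injective e &
    [/\ disjoint_maps e e1, disjoint_maps e e2, disjoint_maps e e3 & disjoint_maps e e4].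
Proof.
move=> dI; pose s := codom e1 ++ codom e2 ++ codom e3 ++ codom e4.
have dC : d <= #|[predC s]|.
  have := cardC (mem s) => /esym IE; move: dI; rewrite IE.
  have : #|mem s| <= 4 * d.
    apply: leq_trans (card_size s) _.
    by rewrite !size_cat !size_codom card_ord !mulSn mul0n addn0.
  move=> s4 d5; rewrite -(leq_add2l (4 * d)) -mulSnr.
  by apply: leq_trans d5 _; rewrite leq_add2r.
have i0 : I := e1 x0.
pose t := enum [predC s]; pose e (x : 'I_d) := nth i0 t x.
have xt (x : 'I_d) : x < size t by rewrite -cardE; apply: leq_trans dC.
have es x : e x \notin s by have := mem_nth i0 (xt x); rewrite mem_enum.
exists e => [x y /eqP|].
  by rewrite nth_uniq ?enum_uniq // => /eqP/val_inj.
by split=> x y exy; have := es x; rewrite exy !mem_cat codom_f ?orbT.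
Qed.

(** Merges are indexed by injections, and [dj] is disjointness of images. Overlapping merges with a
    common coarsening coincide by [overlapping_joins]; disjoint ones can be performed one after the
    other. *)
Lemma part_flexible P : 5 * d <= part_rank P -> flexible coarser part_rank P.
Proof.
have [dP _] := partP P; have [I [phi [Pn fphi PE]]] := part_framing P; rewrite -Pn => dI.
have dspan (J : finType) (psi : J -> chart) : framing psi -> span phi `<=` span psi ->
    is_part (span psi) #|J|.
  by move=> fpsi sub; split; [apply: deepS sub _; rewrite -PE|exists J, psi].
have mpart (e : {e : 'I_d -> I | injective e}) :
    is_part (span (@merged I phi (sval e))) #|{: option {i | i \notin codom (sval e)}}|.
  apply: dspan; first exact/framing_merged/(proj2_sig e).
  by rewrite span_merged; apply: subsetUl.
exists {e : 'I_d -> I | injective e}, (fun p => Part (mpart p)),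
  (fun p q => disjoint_maps (sval p) (sval q)).
split.
- have [i0] : inhabited I.
    have /card_gt0P[i _] : 0 < #|I| by apply: leq_trans dI; rewrite muln_gt0 (ltnW d_gt1).
    by exists.
  have [e inj_e _] := free_map (fun=> i0) (fun=> i0) (fun=> i0) (fun=> i0) dI.
  by exists; exists e.
- move=> e; split; first by rewrite /coarser /= PE span_merged; apply: subsetUl.
  by rewrite -Pn; apply/card_merged_lt/(proj2_sig e).
- by move=> e e'; apply: disjoint_maps_sym.
- move=> Q QP neq; have [e inj_e eQ] := merge_coarser fphi PE QP neq.
  by exists (exist _ e inj_e).
split=> [e1 e2 e3 e4|e e' Q Qe Qe'|[e ie] [e' ie'] /= ee'|[e ie] [e' ie'] [e2 ie2] /= ee' ee2 e'e2].
- have [e inj_e H] := free_map (sval e1) (sval e2) (sval e3) (sval e4) dI.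
  by exists (exist _ e inj_e).
- have [dee|ndee] := pselect (disjoint_maps (sval e) (sval e')); first by right.
  left; apply: part_eq => /=; rewrite !span_merged.
  have [x [y exy]] : exists x y, sval e x = sval e' y.
    apply: contrapT => H; apply: ndee => x y exy; apply: H.
    by exists x, y.
  have [J [psi [_ fpsi QE]]] := part_framing Q.
  have Qj : span psi (join phi (sval e)).
    by rewrite -QE; apply: Qe; rewrite /= span_merged; right; apply: sub_chart_refl.
  have Qj' : span psi (join phi (sval e')).
    by rewrite -QE; apply: Qe'; rewrite /= span_merged; right; apply: sub_chart_refl.
  congr (_ `|` _); apply/seteqP; split=> f; apply: sub_chart_trans.
    exact: (overlapping_joins fpsi Qj' Qj (esym exy)).
  exact: (overlapping_joins fpsi Qj Qj' exy).
- have [J [psi [fpsi psiE]]] := meet2_framing fphi ie ie' ee'.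
  have psiP : is_part (span psi) #|J|.
    by apply: dspan => //; rewrite psiE => f; left; left.
  exists (Part psiP); rewrite /coarser /= psiE !span_merged; split.
  + by apply: subsetUl.
  + by move=> f [|]; [left; left|right].
  + by move=> Q Qe Qe' f [/Qe|?] //; apply: Qe'; right.
- have [J [psi [fpsi psiE]]] := meet3_framing fphi ie ie' ie2 ee' ee2 e'e2.
  have psiP : is_part (span psi) #|J|.
    by apply: dspan => //; rewrite psiE => f; left; left; left.
  exists (Part psiP); rewrite /coarser /= psiE !span_merged; split.
  + by move=> f; left; left.
  + by move=> f [|]; [left; left; left|left; right].
  + by move=> f [|]; [left; left; left|right].
Qed.

(** The balls of [phi] are cut into finitely many balls of [psi], and a word at least as long as all
    the words that locate these lands inside one of them. *)
Lemma span_long (I J : finType) (phi : I -> chart) (psi : J -> chart) :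
  framing phi -> framing psi -> span psi `<=` span phi ->
  exists M, forall i u h, W h -> M <= size u -> span psi (phi i \o shift u h).
Proof.
move=> fphi fpsi sub; have [q qE] := span_choice sub.
exists (\max_j size (q j).1.2) => i u h Wh Mu.
have [j [b jb]] := fpsi.1 (phi i (shift u h b0)).
have [Wj jE] := qE j; rewrite jE in jb.
have ju : size (q j).1.2 <= size u.
  by apply: leq_trans Mu; apply: (leq_bigmax (F := fun j => size (q j).1.2)).
have [ji [t ut]] := framing_meet fphi jb ju; exists j.
apply: (@sub_chart_cat (phi i) _ _ (q j).1.2 t (q j).2 h) => // b1.
  by rewrite jE ji.
by rewrite -ut.
Qed.

Definition std_framing N (p : 'I_k * N.-tuple 'I_d) : chart := std p.1 p.2.

Lemma framing_std N : framing (@std_framing N).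
Proof.
split=> [[a b]|[a w] [a' w'] b c].
  have bN : size (mkseq b N) == N by rewrite size_mkseq.
  exists (a, Tuple bN), (fun i => b (N + i)).
  by rewrite /std_framing /std /= -catr_split.
rewrite /std_framing /std /= => -[-> /catr_inj]; rewrite !size_tuple.
by move=> /(_ erefl)[/val_inj -> ->].
Qed.

Lemma span_stdP N a w : N <= size w -> span (@std_framing N) (std a w).
Proof.
move=> Nw; have wN : size (take N w) == N by rewrite size_takel.
exists (a, Tuple wN), (drop N w), 1%g => // b.
by rewrite /std_framing /std /= shift1 -catr_cat cat_take_drop.
Qed.

Lemma std_is_part N : is_part (span (@std_framing N)) (k * d ^ N).
Proof.
split; first by exists N => a w; apply: span_stdP.
exists ('I_k * N.-tuple 'I_d)%type, (@std_framing N); split=> //.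
  by rewrite card_prod card_tuple !card_ord.
exact: framing_std.
Qed.

Definition std_part N : part := Part (std_is_part N).

(** This is what [deep] is for: standard partitions are cofinal, whence directedness. *)
Lemma coarser_std P : exists N0, forall N, N0 <= N -> coarser P (std_part N).
Proof.
have [[N0 dP] _] := partP P; exists N0 => N N0N f [[a w] aw].
have [I [phi [_ _ PE]]] := part_framing P; rewrite PE in dP *.
by apply: span_sub aw; apply: dP; rewrite size_tuple.
Qed.

Lemma coarser_directed P Q : exists R, coarser P R /\ coarser Q R.
Proof.
have [N NP] := coarser_std P; have [M MQ] := coarser_std Q.
by exists (std_part (maxn N M)); split; [apply: NP; apply: leq_maxl|
  apply: MQ; apply: leq_maxr].
Qed.

(** A merge lowers the rank by [d.-1], and by [merge_coarser] one can keep merging among the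
    refinements of [P] until [P] is reached. *)
Lemma coarsen P Q n : coarser P Q -> part_rank P + n * d.-1 <= part_rank Q ->
  exists R, [/\ coarser P R & part_rank R + n * d.-1 = part_rank Q].
Proof.
move=> PQ; elim: n => [|n IHn] Pn; first by exists Q; rewrite addn0.
have d1 : 0 < d.-1 by case: (d) d_gt1 => [|[]].
have [|R [PR Rn]] := IHn.
  by apply: leq_trans Pn; rewrite leq_add2l leq_pmul2r.
have PRd : part_rank P + d.-1 <= part_rank R.
  by rewrite -(leq_add2r (n * d.-1)) Rn -addnA -mulSn.
have neq : P <> R by move=> PR'; move: PRd; rewrite PR' -{2}[part_rank R]addn0 leq_add2l leqNgt d1.
have [I [phi [In fphi RE]]] := part_framing R.
have [e inj_e eP] := merge_coarser fphi RE PR neq.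
have HR : is_part (span (@merged I phi e)) #|{: option {i | i \notin codom e}}|.
  split; last first.
    exists (option {i | i \notin codom e}), (@merged I phi e).
    by split=> //; exact: framing_merged.
  by apply: deepS (proj1 (partP R)); rewrite RE span_merged; apply: subsetUl.
exists (Part HR); split=> //=; rewrite card_merged // -Rn -In mulSn addnA; congr (_ + _).
have dI : d <= #|I| by have := max_card (mem (codom e)); rewrite card_codom // card_ord.
by rewrite -[in d.-1](prednK (ltnW d_gt1)) /= addSnnS prednK ?(ltnW d_gt1) // subnK.
Qed.

(** * The action of AAut_D on partitions *)

Lemma framing_transport (I : finType) (phi psi : I -> chart) :
  framing phi -> framing psi ->
  exists f : self_bij (ray k d), forall i b, f (phi i b) = psi i b.
Proof.
have H (phi1 phi2 : I -> chart) : framing phi1 -> framing phi2 ->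
    {F : ray k d -> ray k d & forall i b, F (phi1 i b) = phi2 i b}.
  move=> f1 f2; have [F FE] : {F : ray k d -> ray k d & forall r i b,
      phi1 i b = r -> F r = phi2 i b}.
    apply: (@choice _ _ (fun r r' => forall i b, phi1 i b = r -> r' = phi2 i b)) => r.
    have [i [b ib]] := f1.1 r; exists (phi2 i b) => j c jc.
    by have [-> ->] := f1.2 _ _ _ _ (etrans ib (esym jc)).
  by exists F => i b; apply: FE.
move=> fphi fpsi; have [F FE] := H _ _ fphi fpsi; have [G GE] := H _ _ fpsi fphi.
have FG : cancel F G by move=> r; have [i [b <-]] := fphi.1 r; rewrite FE GE.
have GF : cancel G F by move=> r; have [i [b <-]] := fpsi.1 r; rewrite GE FE.
by exists (SelfBij FG GF).
Qed.

Lemma transport_piecewise (I : finType) (phi psi : I -> chart) (f : self_bij (ray k d)) :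
  framing psi -> deep (span phi) -> deep (span psi) ->
  (forall i b, f (phi i b) = psi i b) -> piecewise W f.
Proof.
move=> fpsi [N dphi] [N' dpsi] fE.
have [|M HM] := @span_long _ _ psi (@std_framing N') fpsi (framing_std N').
  by apply: span_subset => -[a w]; apply: dpsi; rewrite size_tuple.
(* The first [N] letters lead into a ball of [phi]; [M] more make the corresponding sub-ball of
   [psi] lie inside a standard ball of depth [N']. *)
exists (N + M) => a w wNM.
have [|i [u [h Wh iE]]] := dphi a (take N w).
  by rewrite size_takel // wNM leq_addr.
have [h' Wh' hE] := shift_comp u (drop N w) Wh.
have [||[a' t] [u' [h2 Wh2 E]]] := HM i (u ++ (aut_fun h (drop N w) : seq 'I_d)) (h' * 1)%g.
- exact: sg_mul.
- by rewrite size_cat td_size size_drop wNM addKn leq_addl.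
exists a', (t ++ u'), h2 => // b.
have := E b; rewrite /std_framing /std /= catr_cat => <-; rewrite -hE -fE -iE.
by rewrite /std shift1 -catr_cat cat_take_drop.
Qed.

(** In contrast to [ray_continuous], the depth [m] may differ from [n] and depend on [r], since
    almost automorphisms shift levels. *)
Lemma ray_locally_determined (F : ray k d -> ray k d) :
  (forall r n, exists m, forall r', ray_vertex r' m = ray_vertex r m ->
     ray_vertex (F r') n = ray_vertex (F r) n) -> continuous F.
Proof.
move=> HF r.
have near_vertex n : nbhs r [set r' | ray_vertex (F r') n = ray_vertex (F r) n].
  by have [m Hm] := HF r n; apply: filterS (nbhs_ray_vertex r m).
have F2 : (fun r' => (F r').2) @ r --> ((F r).2 : {ptws nat -> discrete_topology 'I_d}).
  apply/cvg_sup => n A [B [[C _ <-] Br] BA].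
  apply: filterS (near_vertex n.+2) => r' Er'.
  have E : mkseq (F r').2 n.+1 = mkseq (F r).2 n.+1.
    exact: (congr1 (fun v => if v is Some p then p.2 else [::]) Er').
  apply: (BA (F r').2); move: Br; rewrite /preimage /=.
  by move: E; rewrite !mkseqS => /rcons_inj[_ ->].
move=> A [[B C] /= [/principal_filterP Br HC] BCA].
apply: filterS (filterI (near_vertex 1) (F2 _ HC)) => r' [[E1] Cr'].
by apply: (BCA (F r')); split=> //=; rewrite E1.
Qed.

Lemma piecewise_continuous (f : self_bij (ray k d)) : piecewise W f -> continuous f.
Proof.
move=> [N fN]; apply: ray_locally_determined => -[a b] n; exists (N + n).+1 => -[a' b'] [-> E].
have [a1 [w1 [h _ hE]]] := fN a (mkseq b N) (size_mkseq b N).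
have bE := catr_split b N; have b'E := catr_split b' N.
set c := fun i => b _ in bE; set c' := fun i => b' _ in b'E.
have {E} : mkseq b' N ++ mkseq c' n = mkseq b N ++ mkseq c n.
  by rewrite -!mkseq_catr -bE -b'E !size_mkseq.
move/eqP; rewrite eqseq_cat ?size_mkseq // => /andP[/eqP E /eqP cc'].
rewrite bE b'E E !hE; case: n cc' => // n cc' /=; congr (Some (_, _)).
have [nw|/ltnW wn] := leqP n (size w1); first by rewrite !mkseq_catr_take.
rewrite -(subnKC wn) !mkseq_catr; congr (_ ++ _); rewrite !mkseq_ray_act.
congr (aut_fun h _); have /(congr1 (take (n - size w1))) := cc'.
rewrite /mkseq -!map_take !take_iota (minn_idPl _) //.
by apply: leqW; apply: leq_subr.
Qed.


Implicit Type g : AAutD k D.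

Lemma AAutD_piecewise g : piecewise W (val g).
Proof. exact/almost_aut_piecewise/(sg_valP g). Qed.

Lemma std_long (f : self_bij (ray k d)) : piecewise W f ->
  forall M, exists N, forall a w, N <= size w -> exists a' w', exists2 h, W h &
    M <= size w' /\ forall b, f (std a w b) = std a' w' (ray_act h b).
Proof.
move=> /piecewise_up[N fN] M; exists (N + M) => a w wNM.
have [a' [w' [h Wh hE]]] := fN a (take N w)
  (eq_leq (esym (size_takel (leq_trans (leq_addr M N) wNM)))).
have [h' Wh' h'E] := WD_section (drop N w) Wh.
exists a', (w' ++ (aut_fun h (drop N w) : seq 'I_d)), h' => //; split=> [|b].
  rewrite size_cat td_size size_drop (leq_trans _ (leq_addl _ _)) // leq_subRL //.
  by rewrite (leq_trans _ wNM) // leq_addr.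
rewrite /std -{1}(cat_take_drop N w) catr_cat hE.
by rewrite (ray_act_catr _ h'E) catr_cat.
Qed.

Lemma framing_comp (I : finType) (phi : I -> chart) (f : self_bij (ray k d)) :
  framing phi -> framing (fun i => f \o phi i).
Proof.
move=> fphi; split=> [r|i j b c /= /(can_inj (@bij_funK _ f))]; last exact: fphi.2.
have [i [b ib]] := fphi.1 (bij_inv f r).
by exists i, b; rewrite /= ib bij_invK.
Qed.

Lemma span_comp (I : finType) (phi : I -> chart) (f : ray k d -> ray k d) :
  [set f \o e | e in span phi] = span (fun i => f \o phi i).
Proof.
apply/seteqP; split=> [_ [e [i ie] <-]|e [i [w [h Wh eE]]]].
  by exists i; apply: sub_chart_comp.
exists (phi i \o shift w h); first by exists i; apply: sub_chart_shift.
by apply/funext => b; rewrite eE.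
Qed.

Lemma act_is_part g P :
  is_part [set (val g : self_bij (ray k d)) \o e | e in part_set P] (part_rank P).
Proof.
have [I [phi [In fphi PE]]] := part_framing P; rewrite PE span_comp; split; last first.
  by exists I, (fun i => val g \o phi i); split=> //; apply: framing_comp.
have [[M dP] _] := partP P.
(* Pull [std a w] back by [g^-1]: for long [w] this gives, up to W(D), a standard chart of depth at
   least [M], hence one in [P]. *)
have [N HN] := std_long (piecewiseV (AAutD_piecewise g)) M; exists N => a w Nw.
have [a' [w' [h Wh [Mw' hE]]]] := HN a w Nw.
rewrite -span_comp -PE; exists (std a' w' \o shift [::] h).
  rewrite PE; apply: span_sub (sub_chart_shift _ _ Wh).
  by rewrite -PE; apply: dP.
apply/funext => b; rewrite /= shift_nil -hE.
exact: (@bij_invK _ (val g)).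
Qed.

Definition act g P : part := Part (act_is_part g P).

Lemma act1 P : act 1%g P = P.
Proof.
apply: part_eq; apply/seteqP; split=> [_ [e Pe <-]|e Pe] //.
by exists e.
Qed.

Lemma actM g g' P : act (g * g')%g P = act g (act g' P).
Proof.
apply: part_eq; apply/seteqP; split=> [_ [e Pe <-]|_ [_ [e Pe <-] <-]].
  by exists (val g' \o e) => //; exists e.
by exists e.
Qed.

Lemma coarser_act g P Q : coarser P Q -> coarser (act g P) (act g Q).
Proof. by move=> PQ _ [e /PQ Pe <-]; exists e. Qed.

(** Any bijection between the balls, read in the charts, is piecewise of type W(D), hence comes from
    an element of AAut_D. *)
Lemma act_transitive P Q : part_rank P = part_rank Q -> exists g, act g P = Q.
Proof.
have [I [phi [In fphi PE]]] := part_framing P.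
have [J [psi [Jn fpsi QE]]] := part_framing Q; rewrite -In -Jn => IJ.
pose s (i : I) : J := enum_val (cast_ord IJ (enum_rank i)).
pose s' (j : J) : I := enum_val (cast_ord (esym IJ) (enum_rank j)).
have sK : cancel s s' by move=> i; rewrite /s' /s enum_valK cast_ordK enum_rankK.
have s'K : cancel s' s by move=> i; rewrite /s' /s enum_valK cast_ordKV enum_rankK.
pose psi' i := psi (s i).
have fpsi' : framing psi'.
  split=> [r|i j b c /fpsi.2[/(can_inj sK)]] //.
  by have [j [b jb]] := fpsi.1 r; exists (s' j), b; rewrite /psi' s'K.
have psi'E : span psi' = span psi.
  apply/seteqP; split; apply: span_subset => i; first exact: span_id.
  by rewrite -(s'K i); apply: (span_id psi').
have [f fE] := framing_transport fphi fpsi'.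
have dphi : deep (span phi) by rewrite -PE; case: (partP P).
have dpsi' : deep (span psi') by rewrite psi'E -QE; case: (partP Q).
have pf : piecewise W f := transport_piecewise fpsi' dphi dpsi' fE.
have hf : homeo f.
  by split; [exact: piecewise_continuous|exact: (piecewise_continuous (piecewiseV pf))].
exists (sg_elt (H := AAutD_sg k D) (piecewise_almost_aut hf pf)).
apply: part_eq => /=; rewrite PE QE -psi'E span_comp; congr span.
by apply/funext => i; apply/funext => b; rewrite /= fE.
Qed.

(** [P] has a standard refinement of level [M], whose rank exceeds that of level [N] by a multiple
    of [d.-1]. Merging gives a refinement of [P] with the rank of [std_part N], which is a translate
    of it by transitivity. *)
Lemma act_cofinal N P : part_rank P <= part_rank (std_part N) ->
  exists g, coarser P (act g (std_part N)).
Proof.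
move=> PN; have [N0 NP] := coarser_std P; set M := maxn N N0.
have PM : coarser P (std_part M) by apply: NP; apply: leq_maxr.
have ME : part_rank (std_part N) + k * d ^ N * (\sum_(i < M - N) d ^ i) * d.-1 =
    part_rank (std_part M).
  rewrite /= -mulnA [_ * d.-1]mulnC -predn_exp -mulnS prednK ?expn_gt0 ?(ltnW d_gt1) //.
  by rewrite -mulnA -expnD subnKC // leq_maxl.
have [|R [PR RE]] := coarsen (n := k * d ^ N * (\sum_(i < M - N) d ^ i)) PM.
  by rewrite -ME leq_add2r.
move: RE; rewrite -ME => /eqP; rewrite eqn_add2r => /eqP/esym/act_transitive[g gE].
by exists g; rewrite gE.
Qed.

(** * Finiteness of coarsenings, and of refinements of given rank *)

Lemma finite_coarser (I : finType) (phi : I -> chart) : framing phi ->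
  finite_set [set A | span phi `<=` A /\
    exists (J : finType) (psi : J -> chart), framing psi /\ A = span psi].
Proof.
have [n] := ubnP #|I|; elim: n I phi => // n IHn I phi In fphi.
pose E := [set e : {ffun 'I_d -> I} | injective e].
pose F (e : {ffun 'I_d -> I}) := [set A | span (@merged I phi e) `<=` A /\
    exists (J : finType) (psi : J -> chart), framing psi /\ A = span psi].
(* A strict coarsening is also a coarsening of one of the finitely many merges. *)
apply: (@sub_finite_set _ _ ([set span phi] `|` \bigcup_(e in E) F e)).
  move=> A [phiA [J [psi [fpsi AE]]]]; subst A.
  have [->|neq] := pselect (span phi = span psi); [by left|right].
  have [e inj_e eP] := merge_between fphi fpsi phiA neq.
  have eE : finfun e =1 e by move=> x; rewrite ffunE.
  exists (finfun e); first by move=> x y; rewrite !eE; apply: inj_e.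
  split; last by exists J, psi.
  rewrite span_merged (_ : fun_of_fin (finfun e) = e); last exact/funext.
  by move=> f [/phiA|] //; apply: span_sub.
rewrite finite_setU; split=> //; apply: bigcup_finite => [|e inj_e].
  exact: finite_finset.
apply: IHn; last exact: framing_merged.
by apply: (leq_trans (card_merged_lt inj_e)); rewrite -ltnS.
Qed.

Section Split.
Variables (J : finType) (psi : J -> chart) (j0 : J).

Definition splitted (o : {j | j != j0} + 'I_d) : chart :=
  match o with inl j => psi (val j) | inr x => psi j0 \o catr [:: x] end.

Hypothesis fpsi : framing psi.

Lemma framing_splitted : framing splitted.
Proof.
split=> [r|[i|x] [j|y] b c /= /fpsi.2[]].
- have [j [b <-]] := fpsi.1 r; have [jj0|jj0] := eqVneq j j0; last first.
    by exists (inl (exist _ j jj0)), b.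
  by exists (inr (b 0)), (fun n => b n.+1); rewrite /= bray_cons jj0.
- by move=> ij ->; split=> //; congr inl; apply: val_inj.
- by move=> ij0; case/negP: (valP i); apply/eqP.
- by move=> jj0; case/negP: (valP j); apply/eqP/esym.
- by move=> _ /catr_inj[] // [->] ->.
Qed.

Lemma card_splitted : #|J| < #|{: {j | j != j0} + 'I_d}|.
Proof.
rewrite card_sum card_sig card_ord.
have := cardC1 j0; rewrite -[#|predC1 j0|]/(#|[pred j | j != j0]|) => ->.
have J0 : 0 < #|J| by apply/card_gt0P; exists j0.
by rewrite -{1}(prednK J0) -addn2 leq_add2l.
Qed.

Lemma span_splitted (I : finType) (phi : I -> chart) :
  span phi `<=` span psi -> ~ span phi (psi j0) -> span phi `<=` span splitted.
Proof.
move=> sub nj0 f phif; have [j [w [h Wh fE]]] := sub f phif.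
have [jj0|jj0] := eqVneq j j0; last by exists (inl (exist _ j jj0)), w, h.
case: w fE => [|x w] fE.
  case: nj0; rewrite -jj0; apply: span_sub phif _.
  by apply: (sub_chart_sym Wh) => b; rewrite fE shift_nil.
exists (inr x), w, h => // b.
by rewrite fE jj0 /= /shift -catr_cat.
Qed.
End Split.

(** A strict refinement also refines one of the finitely many partitions obtained by splitting a
    single ball into its children; splitting raises the number of balls, which is bounded by [n]. *)
Lemma finite_finer (J : finType) (psi : J -> chart) (n : nat) : framing psi ->
  finite_set [set B | B `<=` span psi /\
    exists (I : finType) (phi : I -> chart), [/\ #|I| = n, framing phi & B = span phi]].
Proof.
have [m] := ubnP (n.+1 - #|J|); elim: m J psi => // m IHm J psi Jm fpsi.
pose F j := [set B | B `<=` span (@splitted J psi j) /\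
    exists (I : finType) (phi : I -> chart), [/\ #|I| = n, framing phi & B = span phi]].
have [Jn|nJ] := leqP #|J| n; last first.
  apply: (@sub_finite_set _ _ set0) => // B [Bpsi [I [phi [In fphi BE]]]].
  rewrite BE in Bpsi; have [JI _] := framing_rank fphi fpsi Bpsi.
  by move: nJ; rewrite -In ltnNge JI.
apply: (@sub_finite_set _ _ ([set span psi] `|` \bigcup_(j in [set: J]) F j)).
  move=> B [Bpsi [I [phi [In fphi BE]]]]; subst B.
  have [all|] := pselect (forall j, span phi (psi j)).
    by left; apply/seteqP; split=> //; apply: span_subset.
  move=> /existsNP[j nj]; right; exists j => //; split; last by exists I, phi.
  exact: span_splitted.
rewrite finite_setU; split=> //; apply: bigcup_finite => [|j _].
  exact: finite_finset.
apply: IHm; last exact: framing_splitted.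
apply: leq_trans (_ : n.+1 - #|J| <= m); last by rewrite -ltnS.
by apply: ltn_sub2l; [rewrite ltnS|exact: card_splitted].
Qed.

(** * Local compactness and compactness of the generating set *)

Lemma compact_bigcup (X : topologicalType) (I : choiceType) (E : set I) (F : I -> set X) :
  finite_set E -> (forall i, E i -> compact (F i)) -> compact (\bigcup_(i in E) F i).
Proof.
move=> /finite_seqP[s ->] cF; rewrite bigcup_seq big_seq.
by apply: bigsetU_compact => i; apply: cF.
Qed.

Lemma compact_translate g (A : set (AAutD k D)) : compact A ->
  compact [set (g * x)%g | x in A].
Proof.
move=> cA; apply: continuous_compact cA.
exact/continuous_subspaceT/mulg_continuous_l.
Qed.

Lemma AAutD_nbhs_base_compact n : compact (@AAutD_nbhs_base k d D n).
Proof.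
apply: continuous_compact; last exact: Wk_stab_compact.
exact/continuous_subspaceT/Wk_incl_continuous.
Qed.

Lemma AAutD_locally_compact : locally_compact [set: AAutD k D].
Proof.
move=> g _; exists [set (g * x)%g | x in @AAutD_nbhs_base k d D 0].
  by exists 0 => x Ux _; exists x.
split; first exact/compact_translate/AAutD_nbhs_base_compact.
(* Closedness: with [U] the open subgroup, the neighbourhood [y U] of a limit point [y] meets [g U],
   so [y] lies in [g U]. *)
move=> y clU; have [|_ [[x Ux <-] [z Uz xz]]] :=
    clU [set (y * z)%g | z in @AAutD_nbhs_base k d D 0].
  by exists 0 => z Uz; exists z.
exists (x * z^-1)%g; last by rewrite mulgA -xz mulgK.
apply: AAutD_baseM => //; case: Uz => z' z'0 <-; exists z'^-1%g.
  exact: Wk_stabV.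
exact: Wk_inclV.
Qed.

(** Going from [phi] to [psi] and back concatenates two words to the empty one, so both are
    empty. *)
Lemma span_eq_chart (I J : finType) (phi : I -> chart) (psi : J -> chart) i :
  framing phi -> span phi = span psi ->
  exists j, exists2 h, W h & forall b, phi i b = psi j (ray_act h b).
Proof.
move=> fphi E; have [j [w [h Wh iE]]] : span psi (phi i) by rewrite -E; apply: span_id.
have [i' [w' [h' Wh' jE]]] : span phi (psi j) by rewrite E; apply: span_id.
have [h2 Wh2 h2E] := shift_comp w' w Wh'.
have [|_ /esym/(congr1 size)/eqP] := @framing_word _ _ fphi i i' [::]
    (w' ++ (aut_fun h' w : seq 'I_d)) 1%g (h2 * h)%g.
  by move=> b; rewrite shift1 catr0 iE jE h2E.
rewrite size_cat td_size addn_eq0 => /andP[_ /nilP w0].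
by exists j, h => // b; rewrite iE w0 shift_nil.
Qed.

Lemma stab_std_sub N z : @AAutD_nbhs_base k d D N.+1 z -> forall a w, size w = N ->
  exists2 h, W h & forall b, (val z : self_bij (ray k d)) (std a w b) = std a w (ray_act h b).
Proof.
move=> [x xN <-] a w wN; have [p Wp xp] := sg_valP x a.
have pw : p w = w by have := xN (Some (a, w)); rewrite /= wN leqnn xp => /(_ erefl)[].
have [h Wh ph] := WD_section w Wp; exists h => // b.
by rewrite /std /= (Wk_act _ xp) (ray_act_catr _ ph) pw.
Qed.

(** Sort the elements by the map [s] that they induce on balls: there are finitely many [s], and
    each class is empty or a left coset of the compact group [AAutD_nbhs_base N.+1]. The index is
    [N.+1] since words of length [N] sit at that level. *)
Lemma act_std_compact N Q : part_rank Q = part_rank (std_part N) ->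
  compact [set g | act g (std_part N) = Q].
Proof.
move=> QN; have [J [psi [_ fpsi QE]]] := part_framing Q.
pose I := ('I_k * N.-tuple 'I_d)%type.
pose C (s : {ffun I -> J}) : set (AAutD k D) := [set g | forall p, exists2 h, W h &
  forall b, (val g : self_bij (ray k d)) (@std_framing N p b) = psi (s p) (ray_act h b)].
have -> : [set g | act g (std_part N) = Q] = \bigcup_(s in [set: {ffun I -> J}]) C s.
  apply/seteqP; split=> [g gQ|g [s _ gs]]; last first.
    apply/esym/coarser_eq => // _ [e [p pe] <-]; rewrite QE; exists (s p).
    apply: sub_chart_trans (sub_chart_comp _ pe); have [h Wh hE] := gs p.
    by exists [::], h => // b; rewrite shift_nil -hE.
  have E : span (fun p => val g \o @std_framing N p) = span psi.
    by rewrite -span_comp -QE -gQ.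
  have [s sE] : {s : I -> J & forall p, exists2 h, W h & forall b,
      (val g : self_bij (ray k d)) (@std_framing N p b) = psi (s p) (ray_act h b)}.
    apply: (@choice _ _ (fun p j => exists2 h, W h & forall b,
      (val g : self_bij (ray k d)) (@std_framing N p b) = psi j (ray_act h b))) => p.
    exact: (span_eq_chart p (framing_comp _ (@framing_std N)) E).
  by exists (finfun s) => // p; rewrite ffunE.
apply: compact_bigcup => [|s _]; first exact: finite_finset.
have [[x xs]|nC] := pselect (exists x, C s x); last first.
  by rewrite (_ : C s = set0) ?eqEsubset; [exact: compact0|split=> // x xs; case: nC; exists x].
have -> : C s = [set (x * y)%g | y in @AAutD_nbhs_base k d D N.+1].
  apply/seteqP; split=> [g gs|_ [z zN <-] p]; last first.
    have [h Wh hE] := stab_std_sub zN p.1 (size_tuple p.2).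
    have [h' Wh' h'E] := xs p; exists (h' * h)%g => [|b]; first exact: sg_mul.
    by rewrite ray_actM -h'E /std_framing -hE.
  exists (x^-1 * g)%g; last by rewrite mulKVg.
  have [|z zN zE] := @Wk_glue k d D (val (x^-1 * g)%g) N.
    move=> a w wN; have wN' : size w == N by apply/eqP.
    have [h Wh hE] := gs (a, Tuple wN'); have [h' Wh' h'E] := xs (a, Tuple wN').
    exists (h'^-1 * h)%g => [|b]; first by apply: sg_mul => //; apply: sg_inv.
    apply: (can_inj (@bij_funK _ (val x))); rewrite [LHS](@bij_invK _ (val x)).
    have := hE b; rewrite /std_framing /std /= => ->.
    have := h'E (ray_act (h'^-1 * h)%g b); rewrite /std_framing /std /= => ->.
    by rewrite ray_actM ray_actVK.
  by exists z => //; apply: val_inj.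
exact/compact_translate/AAutD_nbhs_base_compact.
Qed.

(** The partitions [g P0] with [g] a step are finite in number: [P0] has finitely many coarsenings,
    each with finitely many refinements of the rank of [P0]. *)
Lemma step_set_compact N : compact (step_set coarser act (std_part N)).
Proof.
pose P0 := std_part N; set S := step_set _ _ _.
pose fr (B : set chart) := exists (I : finType) (phi : I -> chart), framing phi /\ B = span phi.
pose frn (B : set chart) := exists (I : finType) (phi : I -> chart),
  [/\ #|I| = part_rank P0, framing phi & B = span phi].
pose F := \bigcup_(A in [set A | span (@std_framing N) `<=` A /\ fr A])
  [set B | B `<=` A /\ frn B].
have finF : finite_set F.
  apply: bigcup_finite; first exact: (finite_coarser (@framing_std N)).
  by move=> _ [_ [J [psi [fpsi ->]]]]; apply: finite_finer.
pose E := [set B | exists2 g, S g & part_set (act g P0) = B].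
have finE : finite_set E.
  apply: sub_finite_set finF => _ [g [P PP0 Pg] <-]; exists (part_set P); split=> //.
    by have [I [phi [_ fphi ->]]] := part_framing P; exists I, phi.
  exact: part_framing (act g P0).
have -> : S = \bigcup_(B in E) [set g | part_set (act g P0) = B].
  apply/seteqP; split=> [g Sg|g [_ [h [P PP0 Ph] <-] gh]].
    by exists (part_set (act g P0)) => //; exists g.
  by exists P => //; rewrite (part_eq gh).
apply: compact_bigcup => // _ [g Sg <-].
rewrite (_ : [set h | _] = [set h | act h P0 = act g P0]).
  exact: act_std_compact.
by apply/seteqP; split=> h; [exact: (@part_eq (act h P0) (act g P0))|exact: (congr1 part_set)].
Qed.

(** Level 4 is deep enough because [5 <= 2 ^ 3 <= d ^ 3], so that [5 * d <= k * d ^ 4]. *)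
Lemma std_part4_flexible P : 0 < k -> part_rank (std_part 4) < part_rank P ->
  flexible coarser part_rank P.
Proof.
move=> k0 /= PN; apply: part_flexible; apply: leq_trans (ltnW PN).
apply: leq_trans (leq_pmull _ k0); rewrite expnSr leq_pmul2r ?(ltnW d_gt1) //.
by apply: (@leq_trans (2 ^ 3)) => //; rewrite leq_exp2r.
Qed.

End Charts.

Theorem theorem1p1 (k d : nat) (hk : 1 <= k) (hd : 2 <= d)
    (D : {group 'S_d}) :
  compactly_presented (AAutD k D).
Proof.
split; first exact: AAutD_locally_compact.
pose P0 := std_part k D 4.
exists (step_set (@coarser k d D) (@act k d D) P0).
split; first exact: step_set_compact.
exists [set r | size r <= 3 /\ gword_eval (fun x => val x) r = 1%g], 3.
split=> [r []|] //.
have flex (P : part k D) : part_rank P0 < part_rank P ->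
  flexible (@coarser k d D) (@part_rank k d D) P by exact: std_part4_flexible.
exact: (action_presentation (@coarser_refl k d D) (@coarser_trans k d D)
  (coarser_anti hd) (coarser_rank hd) (coarser_eq hd) (@coarser_directed k d D)
  (act1 hd) (actM hd) (@coarser_act k d D) (fun g P => erefl) flex
  (act_cofinal hd (N := 4))).
Qed.
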